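(* The minimum size of complete $(n,3)$-arcs in $PG(2,16)$ is $15$; that is, there exists a complete $(15,3)$-arc in $PG(2,16)$, and every complete $(n,3)$-arc in $PG(2,16)$ satisfies $n \ge 15$.
   Context: $PG(2,q)$ denotes the projective plane over the finite field $GF(q)$ with $q$ elements. An $(n,r)$-arc in $PG(2,q)$ is a set of $n$ points such that no $r+1$ of the points are collinear and some $r$ of the points are collinear. An $(n,r)$-arc is called complete if it is not contained in an $(n+1,r)$-arc of the same projective plane. *)

(* Defs.v *)
From HB Require Import structures.
From mathcomp Require Import all_boot all_order all_algebra.

Set Implicit Arguments.
Unset Strict Implicit.
Unset Printing Implicit Defensive.

(* The library only makes {vspace vT} a choiceType; over a finite field there
   are finitely many subspaces.  The subType structure used here is only visible
   inside VectorInternalTheory. *)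
Import VectorInternalTheory.
HB.instance Definition _ (F : finFieldType) (vT : vectType F) :=
  [Countable of {vspace vT} by <:].
HB.instance Definition _ (F : finFieldType) (vT : vectType F) :=
  [Finite of {vspace vT} by <:].

Section ProjectivePlane.

Variable F : finFieldType.

(* PG(2,q) for q = #|F|. *)
Definition pg2_point := {U : {vspace 'rV[F]_3} | \dim U == 1}.
Definition pg2_line := {U : {vspace 'rV[F]_3} | \dim U == 2}.

HB.instance Definition _ := SubFinite.on pg2_point.
HB.instance Definition _ := SubFinite.on pg2_line.

Definition incident (P : pg2_point) (L : pg2_line) : bool :=
  (val P <= val L)%VS.

Definition collinear (A : {set pg2_point}) : bool :=
  [exists L : pg2_line, [forall P in A, incident P L]].

Definition is_arc (n r : nat) (K : {set pg2_point}) : Prop :=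
  [/\ #|K| = n,
      forall A : {set pg2_point}, A \subset K -> #|A| = r.+1 -> ~~ collinear A
    & exists A : {set pg2_point}, [/\ A \subset K, #|A| = r & collinear A]].

Definition complete_arc (n r : nat) (K : {set pg2_point}) : Prop :=
  is_arc n r K /\
  ~ (exists K' : {set pg2_point}, is_arc n.+1 r K' /\ K \subset K').

End ProjectivePlane.

(* Main.v *)
(** Let K be a complete (n,3)-arc with n <= 14 and t trisecants. The points outside K on a
    line meeting K in one or two points all lie on trisecants, and on distinct ones, which
    bounds t from below; double counting then yields a subset K' of 12 points of K with at
    least 17 trisecants. Some point of K' lies on five of them, so K' contains a
    seven-point core, determined up to collineation by a pair of nonzero field elements,
    and relabelling and Frobenius leave 15 classes of cores. For each class, once the
    previous ones are excluded, a branch and bound search enumerates the possible K' and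
    checks that at most two further points never cover the remaining points of the plane.
    Conversely an explicit arc of 15 points is complete. The computations take place in a
    concrete model of PG(2,16), transported to an arbitrary field with 16 elements. *)

(* Write deg x for the number of trisecants through x, so that the degrees sum to 3t. A tangent at x
   gives deg x <= t - 16, while deg x <= (n - 1)/2 because the trisecants through x pair off other
   points. On average the two are incompatible for n < 12; for n = 13 or 14 they leave room to
   delete points of low degree, so one search of fixed size 12 serves all n <= 14. The threshold 17
   works twice. As 3 * 17 > 12 * 4, some point e has degree 5, the largest possible, and all but one
   of the other eleven points are paired on trisecants through e, which yields the core. And a
   partial choice that cannot reach 17 trisecants is cut. The points of K outside K' are never
   searched for: a counting bound deals with them, and individual pairs are tested only where it
   does not decide. Excluding the classes in a fixed order lets a branch be cut as soon as it shows
   a core of an earlier class. The procedure that looks for such cores need not find all of them: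
   missing one costs only time. *)
From HB Require Import structures.
Require Import Defs.
From mathcomp Require Import all_boot all_order all_algebra all_field.
From mathcomp Require Import ring zify.

Set Implicit Arguments.
Unset Strict Implicit.
Unset Printing Implicit Defensive.

Import GRing.Theory.

(** * The field GF(16) and the points of its projective plane *)

(* The constructor named by the hexadecimal digit n is the polynomial over GF(2) with
   coefficients the binary digits of n, modulo X^4 + X + 1. *)
Inductive gf := k0 | k1 | k2 | k3 | k4 | k5 | k6 | k7 | k8 | k9 | ka | kb | kc | kd | ke | kf.
Definition gadd (a b : gf) : gf :=
  match a with
  | k0 => b
  | k1 => match b with k0 => k1 | k1 => k0 | k2 => k3 | k3 => k2 | k4 => k5 | k5 => k4 | k6 => k7 | k7 => k6 | k8 => k9 | k9 => k8 | ka => kb | kb => ka | kc => kd | kd => kc | ke => kf | kf => ke end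
  | k2 => match b with k0 => k2 | k1 => k3 | k2 => k0 | k3 => k1 | k4 => k6 | k5 => k7 | k6 => k4 | k7 => k5 | k8 => ka | k9 => kb | ka => k8 | kb => k9 | kc => ke | kd => kf | ke => kc | kf => kd end
  | k3 => match b with k0 => k3 | k1 => k2 | k2 => k1 | k3 => k0 | k4 => k7 | k5 => k6 | k6 => k5 | k7 => k4 | k8 => kb | k9 => ka | ka => k9 | kb => k8 | kc => kf | kd => ke | ke => kd | kf => kc end
  | k4 => match b with k0 => k4 | k1 => k5 | k2 => k6 | k3 => k7 | k4 => k0 | k5 => k1 | k6 => k2 | k7 => k3 | k8 => kc | k9 => kd | ka => ke | kb => kf | kc => k8 | kd => k9 | ke => ka | kf => kb end
  | k5 => match b with k0 => k5 | k1 => k4 | k2 => k7 | k3 => k6 | k4 => k1 | k5 => k0 | k6 => k3 | k7 => k2 | k8 => kd | k9 => kc | ka => kf | kb => ke | kc => k9 | kd => k8 | ke => kb | kf => ka end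
  | k6 => match b with k0 => k6 | k1 => k7 | k2 => k4 | k3 => k5 | k4 => k2 | k5 => k3 | k6 => k0 | k7 => k1 | k8 => ke | k9 => kf | ka => kc | kb => kd | kc => ka | kd => kb | ke => k8 | kf => k9 end
  | k7 => match b with k0 => k7 | k1 => k6 | k2 => k5 | k3 => k4 | k4 => k3 | k5 => k2 | k6 => k1 | k7 => k0 | k8 => kf | k9 => ke | ka => kd | kb => kc | kc => kb | kd => ka | ke => k9 | kf => k8 end
  | k8 => match b with k0 => k8 | k1 => k9 | k2 => ka | k3 => kb | k4 => kc | k5 => kd | k6 => ke | k7 => kf | k8 => k0 | k9 => k1 | ka => k2 | kb => k3 | kc => k4 | kd => k5 | ke => k6 | kf => k7 end
  | k9 => match b with k0 => k9 | k1 => k8 | k2 => kb | k3 => ka | k4 => kd | k5 => kc | k6 => kf | k7 => ke | k8 => k1 | k9 => k0 | ka => k3 | kb => k2 | kc => k5 | kd => k4 | ke => k7 | kf => k6 end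
  | ka => match b with k0 => ka | k1 => kb | k2 => k8 | k3 => k9 | k4 => ke | k5 => kf | k6 => kc | k7 => kd | k8 => k2 | k9 => k3 | ka => k0 | kb => k1 | kc => k6 | kd => k7 | ke => k4 | kf => k5 end
  | kb => match b with k0 => kb | k1 => ka | k2 => k9 | k3 => k8 | k4 => kf | k5 => ke | k6 => kd | k7 => kc | k8 => k3 | k9 => k2 | ka => k1 | kb => k0 | kc => k7 | kd => k6 | ke => k5 | kf => k4 end
  | kc => match b with k0 => kc | k1 => kd | k2 => ke | k3 => kf | k4 => k8 | k5 => k9 | k6 => ka | k7 => kb | k8 => k4 | k9 => k5 | ka => k6 | kb => k7 | kc => k0 | kd => k1 | ke => k2 | kf => k3 end
  | kd => match b with k0 => kd | k1 => kc | k2 => kf | k3 => ke | k4 => k9 | k5 => k8 | k6 => kb | k7 => ka | k8 => k5 | k9 => k4 | ka => k7 | kb => k6 | kc => k1 | kd => k0 | ke => k3 | kf => k2 end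
  | ke => match b with k0 => ke | k1 => kf | k2 => kc | k3 => kd | k4 => ka | k5 => kb | k6 => k8 | k7 => k9 | k8 => k6 | k9 => k7 | ka => k4 | kb => k5 | kc => k2 | kd => k3 | ke => k0 | kf => k1 end
  | kf => match b with k0 => kf | k1 => ke | k2 => kd | k3 => kc | k4 => kb | k5 => ka | k6 => k9 | k7 => k8 | k8 => k7 | k9 => k6 | ka => k5 | kb => k4 | kc => k3 | kd => k2 | ke => k1 | kf => k0 end
  end.
Definition gmul (a b : gf) : gf :=
  match a with
  | k0 => k0
  | k1 => b
  | k2 => match b with k0 => k0 | k1 => k2 | k2 => k4 | k3 => k6 | k4 => k8 | k5 => ka | k6 => kc | k7 => ke | k8 => k3 | k9 => k1 | ka => k7 | kb => k5 | kc => kb | kd => k9 | ke => kf | kf => kd end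
  | k3 => match b with k0 => k0 | k1 => k3 | k2 => k6 | k3 => k5 | k4 => kc | k5 => kf | k6 => ka | k7 => k9 | k8 => kb | k9 => k8 | ka => kd | kb => ke | kc => k7 | kd => k4 | ke => k1 | kf => k2 end
  | k4 => match b with k0 => k0 | k1 => k4 | k2 => k8 | k3 => kc | k4 => k3 | k5 => k7 | k6 => kb | k7 => kf | k8 => k6 | k9 => k2 | ka => ke | kb => ka | kc => k5 | kd => k1 | ke => kd | kf => k9 end
  | k5 => match b with k0 => k0 | k1 => k5 | k2 => ka | k3 => kf | k4 => k7 | k5 => k2 | k6 => kd | k7 => k8 | k8 => ke | k9 => kb | ka => k4 | kb => k1 | kc => k9 | kd => kc | ke => k3 | kf => k6 end
  | k6 => match b with k0 => k0 | k1 => k6 | k2 => kc | k3 => ka | k4 => kb | k5 => kd | k6 => k7 | k7 => k1 | k8 => k5 | k9 => k3 | ka => k9 | kb => kf | kc => ke | kd => k8 | ke => k2 | kf => k4 end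
  | k7 => match b with k0 => k0 | k1 => k7 | k2 => ke | k3 => k9 | k4 => kf | k5 => k8 | k6 => k1 | k7 => k6 | k8 => kd | k9 => ka | ka => k3 | kb => k4 | kc => k2 | kd => k5 | ke => kc | kf => kb end
  | k8 => match b with k0 => k0 | k1 => k8 | k2 => k3 | k3 => kb | k4 => k6 | k5 => ke | k6 => k5 | k7 => kd | k8 => kc | k9 => k4 | ka => kf | kb => k7 | kc => ka | kd => k2 | ke => k9 | kf => k1 end
  | k9 => match b with k0 => k0 | k1 => k9 | k2 => k1 | k3 => k8 | k4 => k2 | k5 => kb | k6 => k3 | k7 => ka | k8 => k4 | k9 => kd | ka => k5 | kb => kc | kc => k6 | kd => kf | ke => k7 | kf => ke end
  | ka => match b with k0 => k0 | k1 => ka | k2 => k7 | k3 => kd | k4 => ke | k5 => k4 | k6 => k9 | k7 => k3 | k8 => kf | k9 => k5 | ka => k8 | kb => k2 | kc => k1 | kd => kb | ke => k6 | kf => kc end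
  | kb => match b with k0 => k0 | k1 => kb | k2 => k5 | k3 => ke | k4 => ka | k5 => k1 | k6 => kf | k7 => k4 | k8 => k7 | k9 => kc | ka => k2 | kb => k9 | kc => kd | kd => k6 | ke => k8 | kf => k3 end
  | kc => match b with k0 => k0 | k1 => kc | k2 => kb | k3 => k7 | k4 => k5 | k5 => k9 | k6 => ke | k7 => k2 | k8 => ka | k9 => k6 | ka => k1 | kb => kd | kc => kf | kd => k3 | ke => k4 | kf => k8 end
  | kd => match b with k0 => k0 | k1 => kd | k2 => k9 | k3 => k4 | k4 => k1 | k5 => kc | k6 => k8 | k7 => k5 | k8 => k2 | k9 => kf | ka => kb | kb => k6 | kc => k3 | kd => ke | ke => ka | kf => k7 end
  | ke => match b with k0 => k0 | k1 => ke | k2 => kf | k3 => k1 | k4 => kd | k5 => k3 | k6 => k2 | k7 => kc | k8 => k9 | k9 => k7 | ka => k6 | kb => k8 | kc => k4 | kd => ka | ke => kb | kf => k5 end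
  | kf => match b with k0 => k0 | k1 => kf | k2 => kd | k3 => k2 | k4 => k9 | k5 => k6 | k6 => k4 | k7 => kb | k8 => k1 | k9 => ke | ka => kc | kb => k3 | kc => k8 | kd => k7 | ke => k5 | kf => ka end
  end.
Definition ginv (a : gf) : gf :=
  match a with k0 => k0 | k1 => k1 | k2 => k9 | k3 => ke | k4 => kd | k5 => kb | k6 => k7 | k7 => k6 | k8 => kf | k9 => k2 | ka => kc | kb => k5 | kc => ka | kd => k4 | ke => k3 | kf => k8 end.
Definition geq (a b : gf) : bool :=
  match a, b with
  | k0, k0 | k1, k1 | k2, k2 | k3, k3 | k4, k4 | k5, k5 | k6, k6 | k7, k7 | k8, k8 | k9, k9 | ka, ka | kb, kb | kc, kc | kd, kd | ke, ke | kf, kf => true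
  | _, _ => false
  end.
Definition gfs : seq gf := [:: k0; k1; k2; k3; k4; k5; k6; k7; k8; k9; ka; kb; kc; kd; ke; kf].

Lemma geqP : Equality.axiom geq.
Proof. by case; case; constructor. Qed.
HB.instance Definition _ := hasDecEq.Build gf geqP.

Lemma gf_pcan : pcancel (index^~ gfs) (nth None (map some gfs)).
Proof. by case. Qed.
HB.instance Definition _ := Countable.copy gf (pcan_type gf_pcan).

Lemma gfs_finite : Finite.axiom gfs.
Proof. by case. Qed.
HB.instance Definition _ := isFinite.Build gf gfs_finite.

Lemma gf_ind1 (Q : gf -> bool) : all Q gfs -> forall a, Q a.
Proof. by move/allP=> h a; apply: h; case: a. Qed.
Lemma gf_ind2 (Q : gf -> gf -> bool) :
  all (fun a => all (Q a) gfs) gfs -> forall a b, Q a b.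
Proof. by move=> h a; apply: gf_ind1; move: a; exact: gf_ind1. Qed.
Lemma gf_ind3 (Q : gf -> gf -> gf -> bool) :
  all (fun a => all (fun b => all (Q a b) gfs) gfs) gfs ->
  forall a b c, Q a b c.
Proof. by move=> h a; apply: gf_ind2; move: a; exact: gf_ind1. Qed.

Lemma gaddA : associative gadd.
Proof. by move=> a b c; apply/geqP; move: a b c; apply: gf_ind3; vm_compute. Qed.
Lemma gaddC : commutative gadd.
Proof. by move=> a b; apply/geqP; move: a b; apply: gf_ind2; vm_compute. Qed.
Lemma gadd0 : left_id k0 gadd.
Proof. by []. Qed.
Lemma gaddN : left_inverse k0 id gadd.
Proof. by case. Qed.
HB.instance Definition _ := GRing.isZmodule.Build gf gaddA gaddC gadd0 gaddN.

Lemma gmulA : associative gmul.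
Proof. by move=> a b c; apply/geqP; move: a b c; apply: gf_ind3; vm_compute. Qed.
Lemma gmulC : commutative gmul.
Proof. by move=> a b; apply/geqP; move: a b; apply: gf_ind2; vm_compute. Qed.
Lemma gmul1 : left_id k1 gmul.
Proof. by []. Qed.
Lemma gmulD : left_distributive gmul gadd.
Proof. by move=> a b c; apply/geqP; move: a b c; apply: gf_ind3; vm_compute. Qed.
HB.instance Definition _ :=
  GRing.Zmodule_isComNzRing.Build gf gmulA gmulC gmul1 gmulD isT.

Lemma gmulV (a : gf) : a != 0%R -> (ginv a * a = 1)%R.
Proof. by case: a. Qed.
Lemma ginv0 : ginv 0%R = 0%R.
Proof. by []. Qed.
HB.instance Definition _ := GRing.ComNzRing_isField.Build gf gmulV ginv0.

Lemma gmulE a b : gmul a b = (a * b)%R. Proof. by []. Qed.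
Lemma ginvE a : ginv a = (a^-1)%R. Proof. by []. Qed.
Lemma goppE (a : gf) : (- a = a)%R. Proof. by []. Qed.
Lemma gaddrr (a : gf) : (a + a = 0)%R. Proof. by case: a. Qed.

(** * Points, lines and determinants in the concrete plane *)

Inductive point := Aff (x y : gf) | Inf (m : gf) | InfV.

Definition point_eq (p q : point) : bool :=
  match p, q with
  | Aff x y, Aff x' y' => if geq x x' then geq y y' else false
  | Inf m, Inf m' => geq m m'
  | InfV, InfV => true
  | _, _ => false
  end.

Lemma point_eqP : Equality.axiom point_eq.
Proof.
case=> [x y|m|] [x' y'|m'|] /=; try by constructor.
  case: geqP => [->|h]; last by constructor; case.
  by case: geqP => [->|h]; constructor => //; case.
by case: geqP => [->|h]; constructor => //; case.
Qed.
HB.instance Definition _ := hasDecEq.Build point point_eqP.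

Definition points : seq point :=
  InfV :: map Inf gfs ++ [seq Aff x y | x <- gfs, y <- gfs].

Lemma mem_points p : p \in points.
Proof. by move: p; case=> [x y|m|]; [move: x y; apply: gf_ind2|move: m; apply: gf_ind1|]; vm_compute. Qed.

Lemma point_pcan : pcancel (index^~ points) (nth None (map some points)).
Proof.
by move=> p; rewrite (nth_map InfV) ?index_mem ?mem_points // nth_index ?mem_points.
Qed.
HB.instance Definition _ := Countable.copy point (pcan_type point_pcan).

Lemma points_uniq : uniq points. Proof. by vm_compute. Qed.
Lemma points_finite : Finite.axiom points.
Proof. by apply: Finite.uniq_enumP points_uniq _ => p; rewrite mem_points. Qed.
HB.instance Definition _ := isFinite.Build point points_finite.

Lemma card_point : #|{: point}| = 273.
Proof. by rewrite cardT enumT unlock. Qed.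

Definition is0 (a : gf) := match a with k0 => true | _ => false end.
Definition slope dx dy := if is0 dx then None else Some (gmul dy (ginv dx)).
(* A name for the line pq within the pencil at p; a junk value when q = p. *)
Definition idx (p q : point) : option gf :=
  match p with
  | Aff x y =>
    match q with
    | Aff x' y' => slope (gadd x' x) (gadd y' y)
    | Inf m => Some m
    | InfV => None
    end
  | Inf m => match q with Aff x y => Some (gadd y (gmul m x)) | _ => None end
  | InfV => match q with Aff x _ => Some x | _ => None end
  end.

Definition oeq (a b : option gf) : bool :=
  match a, b with Some x, Some y => geq x y | None, None => true | _, _ => false end.

Lemma oeqE a b : oeq a b = (a == b).
Proof. by case: a b => [a|] [b|]. Qed.

Definition vec := (gf * gf * gf)%type.
Definition rep (p : point) : vec :=
  match p with Aff x y => (x, y, k1) | Inf m => (k1, m, k0) | InfV => (k0, k1, k0) end.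
(** The expansion along the first row; in characteristic 2 its minus signs become plus. *)
Definition det (u v w : vec) : gf :=
  let: (u1, u2, u3) := u in let: (v1, v2, v3) := v in let: (w1, w2, w3) := w in
  gadd (gmul u1 (gadd (gmul v2 w3) (gmul v3 w2)))
    (gadd (gmul u2 (gadd (gmul v3 w1) (gmul v1 w3)))
          (gmul u3 (gadd (gmul v1 w2) (gmul v2 w1)))).
Definition col p q r := det (rep p) (rep q) (rep r) == k0.

Local Open Scope ring_scope.

Lemma gadd_eq0 (a b : gf) : (a + b == 0) = (a == b).
Proof. by rewrite -[b in LHS]goppE subr_eq0. Qed.

Lemma is0E a : is0 a = (a == 0). Proof. by case: a. Qed.

Lemma slope_eq (x y x' y' : gf) : (x != 0) || (y != 0) -> (x' != 0) || (y' != 0) ->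
  (slope x y == slope x' y') = (x * y' == x' * y).
Proof.
rewrite /slope !is0E !ginvE !gmulE.
have [->|x0] := eqVneq x 0; have [->|x'0] := eqVneq x' 0 => /= h h'.
- by rewrite !mul0r.
- by rewrite mul0r [RHS]eq_sym mulf_eq0 (negPf x'0) (negPf h).
- by rewrite mul0r mulf_eq0 (negPf x0) (negPf h').
- by rewrite (inj_eq (@Some_inj _)) eqr_div // [LHS]eq_sym [y' * x]mulrC [y * x']mulrC.
Qed.

Lemma gsubE (a b : gf) : a - b = a + b. Proof. by []. Qed.

Lemma detE (u1 u2 u3 v1 v2 v3 w1 w2 w3 : gf) :
  det (u1, u2, u3) (v1, v2, v3) (w1, w2, w3) =
  u1 * (v2 * w3 - v3 * w2) + u2 * (v3 * w1 - v1 * w3) + u3 * (v1 * w2 - v2 * w1).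
Proof. by rewrite !gsubE -addrA. Qed.

(** This links the fast test of the search, comparing names in the pencil at p, with the
    determinant, from which symmetry and invariance under collineations follow. *)
Lemma idx_col p q r : q != p -> r != p -> (idx p q == idx p r) = col p q r.
Proof.
have E a b c d : (Aff a b != Aff c d) = (a + c != 0) || (b + d != 0).
  by rewrite !gadd_eq0 -negb_and.
have B (a b : gf) : gadd a b = a - b by [].
(* Points at infinity are read as directions (1, c) or (0, 1), so that [slope_eq] also settles the
   mixed cases. *)
have SM (c : gf) : Some c = slope 1 c by case: c.
have SN : None = slope 0 (1 : gf) by [].
have simp := (mul0r, mulr0, mul1r, mulr1, add0r, addr0, sub0r, subr0, oppr0, eqxx).
case: p q r => [x y|m|] [x1 y1|m1|] [x2 y2|m2|] // n1 n2;
  rewrite /col /idx /rep detE -[k0]/(0 : gf) -[k1]/(1 : gf) ?E ?gmulE ?B;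
  rewrite ?E in n1 n2.
- rewrite slope_eq // -subr_eq0 ; congr (_ == 0); ring.
- rewrite (SM m2) slope_eq ?oner_eq0 // -subr_eq0; congr (_ == 0); ring.
- rewrite SN slope_eq ?oner_eq0 ?orbT // -subr_eq0; congr (_ == 0); ring.
- rewrite (SM m1) slope_eq ?oner_eq0 // -subr_eq0; congr (_ == 0); ring.
- rewrite (inj_eq (@Some_inj _)) eq_sym -subr_eq0; congr (_ == 0); ring.
- by rewrite !simp.
- rewrite SN slope_eq ?oner_eq0 ?orbT // -subr_eq0; congr (_ == 0); ring.
- by rewrite !simp.
- by rewrite !simp.
- rewrite (inj_eq (@Some_inj _)) -subr_eq0; congr (_ == 0); ring.
- by rewrite !simp [_ + m]addrC subr_eq0 [m == _]eq_sym (negPf n2 : (m2 == m) = false).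
- by rewrite !simp.
- by rewrite !simp subr_eq0 (negPf n1 : (m1 == m) = false).
- by rewrite !simp.
- by rewrite !simp.
- by rewrite !simp.
- by rewrite !simp.
- by rewrite !simp.
- by rewrite !simp subr_eq0 eq_sym (inj_eq (@Some_inj _)).
- by rewrite !simp.
Qed.

Lemma det_perm (u v w : vec) : (det u v w = det v u w) * (det u v w = det u w v).
Proof.
case: u v w => [[u1 u2] u3] [[v1 v2] v3] [[w1 w2] w3].
split; rewrite -[RHS]goppE !detE; ring.
Qed.

Lemma col_perm p q r : (col p q r = col q p r) * (col p q r = col p r q).
Proof.
case: (det_perm (rep p) (rep q) (rep r)) => e1 e2.
by split; congr (_ == _); [exact: e1 | exact: e2].
Qed.

Lemma col_dup p q : col p p q.
Proof.
rewrite /col; case: (rep p) (rep q) => [[u1 u2] u3] [[v1 v2] v3].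
by rewrite detE; apply/eqP; rewrite -[k0]/(0 : gf); ring.
Qed.

Lemma card_pencil p i : #|[set q | q != p & idx p q == i]| = 16%N.
Proof.
have: all (fun p => all (fun i => count (fun q => ~~ point_eq q p && oeq (idx p q) i) points == 16%N)
           (None :: map some gfs)) points by vm_compute.
move/allP=> /(_ _ (mem_points p)) /allP /(_ i) H.
have E : enum {: point} = points by rewrite enumT unlock.
rewrite cardE /enum_mem size_filter -enumT E -[RHS](eqP (H _)); last by case: (i) => // a; case: a.
by apply: eq_count => q; rewrite !inE oeqE.
Qed.

Local Close Scope ring_scope.

(** * Bisecants and trisecants *)

Lemma colC p q r : col p q r = col q p r. Proof. exact: (col_perm p q r).1. Qed.
Lemma colAC p q r : col p q r = col p r q. Proof. exact: (col_perm p q r).2. Qed.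

Lemma col_trans p q r s : p != q -> col p q r -> col p q s -> col p r s.
Proof.
move=> pq.
have [->|rp] := eqVneq r p; first by rewrite col_dup.
have [->|sp] := eqVneq s p; first by move=> _ _; rewrite colAC col_dup.
rewrite eq_sym in pq.
by rewrite -!idx_col // => /eqP <- /eqP <-.
Qed.

Fixpoint pairs (T : Type) (s : seq T) : seq (T * T) :=
  if s is a :: s' then map (pair a) s' ++ pairs s' else [::].

(** For x outside an arc s this is also the number of trisecants that adding x creates. *)
Definition bisecants (x : point) (s : seq point) : nat :=
  count (fun p => col x p.1 p.2) (pairs s).

(** Each collinear triple is listed once, in the order of s; when no four points are collinear,
    these triples are the trisecants. *)
Fixpoint blocks (s : seq point) : seq (point * (point * point)) :=
  if s is a :: s' then
    map (pair a) (filter (fun p => col a p.1 p.2) (pairs s')) ++ blocks s'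
  else [::].

Definition trisecants s := size (blocks s).

Lemma bisecants_cons x a s : bisecants x (a :: s) = count (col x a) s + bisecants x s.
Proof. by rewrite /bisecants /= count_cat count_map. Qed.

Lemma trisecants_cons a s : trisecants (a :: s) = bisecants a s + trisecants s.
Proof. by rewrite /trisecants /= size_cat size_map size_filter. Qed.

Lemma bisecants_catCA x a s1 s2 : bisecants x (s1 ++ a :: s2) = bisecants x (a :: s1 ++ s2).
Proof.
elim: s1 => //= b s1 IH; rewrite !bisecants_cons IH bisecants_cons /= !count_cat /=.
rewrite [col x b a]colAC; lia.
Qed.

Lemma trisecants_catCA a s1 s2 : trisecants (s1 ++ a :: s2) = trisecants (a :: s1 ++ s2).
Proof.
elim: s1 => //= b s1 IH; rewrite !trisecants_cons IH trisecants_cons bisecants_catCA !bisecants_cons.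
rewrite (eq_count (colC b a)); lia.
Qed.

(** The counts above are defined by recursion on the list; this reduces their invariance to moving
    one element to the front. *)
Lemma perm_inv (T : eqType) (S : Type) (f : seq T -> S) :
  (forall a s1 s2, f (s1 ++ a :: s2) = f (a :: s1 ++ s2)) ->
  (forall a s1 s2, perm_eq s1 s2 -> f s1 = f s2 -> f (a :: s1) = f (a :: s2)) ->
  forall s1 s2, perm_eq s1 s2 -> f s1 = f s2.
Proof.
move=> fCA fc; elim=> [|a s1 IH] s2.
  by rewrite perm_sym => /perm_nilP ->.
move=> h; have : a \in s2 by rewrite -(perm_mem h) mem_head.
move/splitPr => def; case: def h => t1 t2 h; rewrite fCA.
have {}h : perm_eq s1 (t1 ++ t2).
  by rewrite -(perm_cons a); apply: perm_trans h _; rewrite -cat1s perm_catCA.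
exact: fc (IH _ h).
Qed.

Lemma bisecants_perm x s1 s2 : perm_eq s1 s2 -> bisecants x s1 = bisecants x s2.
Proof.
apply: perm_inv s1 s2 => [|a s1 s2 h e]; first exact: bisecants_catCA.
by rewrite !bisecants_cons e (permP h).
Qed.

Lemma trisecants_perm s1 s2 : perm_eq s1 s2 -> trisecants s1 = trisecants s2.
Proof.
apply: perm_inv s1 s2 => [|a s1 s2 h e]; first exact: trisecants_catCA.
by rewrite !trisecants_cons e (bisecants_perm _ h).
Qed.

Lemma count_sum (T : Type) (a : pred T) s : count a s = \sum_(y <- s) a y.
Proof. by elim: s => [|y s IH]; rewrite ?big_nil // big_cons -IH. Qed.

(** Each pair collinear with x is seen from both of its members. *)
Lemma sum_count_rem x s : uniq s ->
  \sum_(y <- s) count (col x y) (rem y s) = (bisecants x s).*2.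
Proof.
elim: s => [|a s IH] /=; first by rewrite big_nil.
case/andP=> as_ us; rewrite big_cons /= eqxx bisecants_cons doubleD -IH //.
have -> : \sum_(y <- s) count (col x y) (if a == y then s else a :: rem y s)
  = \sum_(y <- s) (col x a y + count (col x y) (rem y s)).
  apply: eq_big_seq => y ys; case: eqP as_ => [->|_ _]; first by rewrite ys.
  by rewrite /= colAC.
by rewrite big_split /= -count_sum; lia.
Qed.

(** Each trisecant is seen from each of its three points. *)
Lemma sum_bisecants_rem s : uniq s -> \sum_(x <- s) bisecants x (rem x s) = 3 * trisecants s.
Proof.
elim: s => [|a s IH] /=; first by rewrite big_nil.
case/andP=> as_ us; rewrite big_cons /= eqxx trisecants_cons.
have -> : \sum_(y <- s) bisecants y (if a == y then s else a :: rem y s)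
  = \sum_(y <- s) (count (col a y) (rem y s) + bisecants y (rem y s)).
  apply: eq_big_seq => y ys; case: eqP as_ => [->|_ _]; first by rewrite ys.
  by rewrite bisecants_cons (eq_count (colC y a)).
by rewrite big_split /= sum_count_rem // IH //; lia.
Qed.

Definition no4 (s : seq point) :=
  forall a b c d, a \in s -> b \in s -> c \in s -> d \in s ->
  uniq [:: a; b; c; d] -> col a b c -> ~~ col a b d.

(** Maximality in pointwise form: adding q would put four points on a line. *)
Definition complete (s : seq point) := forall q, q \notin s ->
  exists a b c, [/\ [/\ a \in s, b \in s & c \in s], uniq [:: a; b; c], col a b c & col a b q].

Lemma mem_pairs_uniq (T : eqType) (s : seq T) a b : uniq s -> (a, b) \in pairs s ->
  [/\ a \in s, b \in s & a != b].
Proof.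
elim: s => //= x s IH /andP[xs us]; rewrite mem_cat !inE.
case/orP=> [/mapP[c cs [-> ->]]|/(IH us)[-> -> ->]]; last by rewrite !orbT.
by rewrite eqxx cs orbT; split=> //; apply: contraNneq xs => ->.
Qed.

Lemma pairsP (T : eqType) (s : seq T) a b : a \in s -> b \in s -> a != b ->
  ((a, b) \in pairs s) || ((b, a) \in pairs s).
Proof.
elim: s => //= x s IH; rewrite !inE !mem_cat.
case/predU1P=> [->|as_]; case/predU1P=> [->|bs]; rewrite ?eqxx // => ab.
- by rewrite (map_f (pair x)).
- by rewrite (map_f (pair x)) // orbT.
- by case/orP: (IH as_ bs ab) => ->; rewrite !orbT.
Qed.

Lemma mem_blocks s a b c : uniq s -> (a, (b, c)) \in blocks s ->
  [/\ [/\ a \in s, b \in s & c \in s], uniq [:: a; b; c] & col a b c].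
Proof.
elim: s => //= x s IH /andP[xs us]; rewrite mem_cat.
case/orP=> [/mapP[[b' c']] | /(IH us) [[ha hb hc] u h]]; last by rewrite !(in_cons x) ha hb hc !orbT.
rewrite mem_filter /= => /andP[h /(mem_pairs_uniq us)[b's c's bc]] [-> -> ->].
rewrite !inE eqxx b's c's !orbT bc andbT h; split=> //; rewrite andbT; apply/norP; split.
  by apply: contraNneq xs => ->.
by apply: contraNneq xs => ->.
Qed.

Lemma blocksP s a b c : a \in s -> b \in s -> c \in s -> uniq [:: a; b; c] -> col a b c ->
  exists2 B, B \in blocks s & perm_eq [:: B.1; B.2.1; B.2.2] [:: a; b; c].
Proof.
elim: s => //= x s IH; rewrite !inE => ha hb hc u h.
pose P a b c := exists2 B, B \in [seq (x, i) | i <- pairs s & col x i.1 i.2] ++ blocks s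
   & perm_eq [:: B.1; B.2.1; B.2.2] [:: a; b; c].
have base b' c' : b' \in s -> c' \in s -> b' != c' -> col x b' c' -> P x b' c'.
  move=> bs cs bc hx; case/orP: (pairsP bs cs bc) => hp.
    by exists (x, (b', c')) => //; rewrite mem_cat map_f // mem_filter hx.
  exists (x, (c', b')); first by rewrite mem_cat map_f // mem_filter /= colAC hx.
  by rewrite /= perm_cons -cat1s perm_catC.
have Pp a1 b1 c1 a2 b2 c2 : perm_eq [:: a1; b1; c1] [:: a2; b2; c2] -> P a1 b1 c1 -> P a2 b2 c2.
  by move=> hp [B Bs h1]; exists B => //; apply: perm_trans h1 hp.
rewrite -/(P a b c).
move: u; rewrite /= negb_or andbT => /andP[/andP[ab ac] bc].
case/predU1P: ha => [ha|ha].
  subst a; apply: base => //.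
    by move: hb; rewrite eq_sym (negPf ab).
  by move: hc; rewrite eq_sym (negPf ac).
case/predU1P: hb => [hb|hb].
  subst b; apply: (Pp x a c); first by rewrite -[[:: x; a; c]]/([:: x] ++ [:: a] ++ [:: c]) perm_catCA.
  apply: base => //; last by rewrite colC.
  by move: hc; rewrite eq_sym (negPf bc).
case/predU1P: hc => [hc|hc].
  subst c; apply: (Pp x a b); first by rewrite -[[:: x; a; b]]/([:: x] ++ [:: a; b]) perm_catC.
  by apply: base => //; rewrite colC colAC.
have [|B Bs hB] := IH ha hb hc _ h; first by rewrite /= !inE negb_or ab ac bc.
by exists B => //; rewrite mem_cat Bs orbT.
Qed.

Definition on_line (p : point) i : pred point := fun q => (q == p) || (idx p q == i).

Lemma on_line_col p i q r s : on_line p i q -> on_line p i r -> q != r ->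
  col q r s -> on_line p i s.
Proof.
rewrite /on_line; have [->//|sp] := eqVneq s p.
have [-> _|qp] := eqVneq q p.
  by move=> /predU1P[->|/eqP <-]; rewrite ?eqxx // => pr; rewrite -idx_col // 1?eq_sym.
have [-> h _|rp /= /eqP hq /eqP hr qr h] := eqVneq r p.
  by move=> _; rewrite colC -idx_col // => /eqP <-.
have h1 : col q r p by rewrite -colAC -colC -idx_col // hq hr.
have := col_trans qr h1 h; rewrite colC -idx_col // => /eqP <-.
by rewrite hq.
Qed.

(** Needed because [blocks] lists a triple in the order of s, so its first two entries can be any
    two of a, b, c. *)
Lemma triple_col a b c q z w : uniq [:: a; b; c] -> col a b c -> col a b q ->
  z \in [:: a; b; c] -> w \in [:: a; b; c] -> z != w -> col z w q.
Proof.
rewrite /= !inE negb_or andbT => /andP[/andP[ab ac] bc] h hq.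
have hac : col a c q := col_trans ab h hq.
have hbc : col b c q by apply: (@col_trans b a c q); rewrite 1?eq_sym // colC.
by move=> /or3P[] /eqP-> /or3P[] /eqP->; rewrite ?eqxx // => _; rewrite // colC.
Qed.

(* Each point outside K of such a line lies on a trisecant, which avoids the points of K on
   that line, and distinct points give distinct trisecants. *)
Lemma line_bound (K : seq point) p i : uniq K -> complete K -> p \in K ->
  count (on_line p i) K <= 2 ->
  17 <= trisecants (filter (predC (on_line p i)) K) + count (on_line p i) K.
Proof.
move=> uK cK pK k2; set s := filter _ K.
have [P [uP sP PE]] : exists P : seq point, [/\ uniq P, size P = 16
    & forall q, (q \in P) = (q != p) && (idx p q == i)].
  exists (enum [set q | q != p & idx p q == i]).
  by rewrite enum_uniq -cardE card_pencil; split=> // q; rewrite mem_enum inE.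
have PL q : q \in P -> on_line p i q by rewrite PE /on_line => /andP[_ ->]; rewrite orbT.
pose us := [seq q <- P | q \notin K].
(* A line has 17 points: p and the 16 points of [P]. *)
have us16 : 17 <= size us + count (on_line p i) K.
  have : size us + size [seq x <- P | x \in K] = 16.
    by rewrite addnC -sP -(count_predC [in K] P) !size_filter.
  have sub : size [seq x <- P | x \in K] <= size [seq x <- K | (on_line p i x) && (x != p)].
    apply: uniq_leq_size; first by rewrite filter_uniq.
    move=> x; rewrite !mem_filter => /andP[-> xP]; rewrite PL //=.
    by move: xP; rewrite PE => /andP[-> _].
  suff : size [seq x <- K | on_line p i x & x != p] + 1 <= count (on_line p i) K by lia.
  rewrite size_filter (permP (perm_to_rem pK)) /= eqxx andbF add0n.
  rewrite [X in _ <= X](permP (perm_to_rem pK)) /= {2}/on_line eqxx addnC leq_add2l.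
  by apply: sub_count => x /andP[].
apply: leq_trans us16 _; rewrite leq_add2r.
have cov q : q \in us -> has (fun B => col B.1 B.2.1 q) (blocks s).
  rewrite mem_filter => /andP[qK qP].
  have [a [b [c [[aK bK cK'] u h hq]]]] := cK q qK.
  (* Otherwise the trisecant through x and q would be the line itself, which would then contain
     three points of K. *)
  have off x y z : x \in K -> y \in K -> z \in K -> uniq [:: x; y; z] -> col x y z ->
    col x y q -> x \in s.
    move=> xK yK zK; rewrite /= !inE negb_or andbT => /andP[/andP[xy xz] yz] hz hxq.
    rewrite mem_filter xK andbT /=; apply/negP => xL.
    have xq : x != q by apply: contraNneq qK => <-.
    have yL : on_line p i y by apply: on_line_col xL (PL _ qP) xq _; rewrite colAC.
    have zL : on_line p i z by apply: on_line_col xL yL xy hz.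
    move: k2; rewrite leqNgt => /negP[].
    rewrite -size_filter; apply: (@uniq_leq_size _ [:: x; y; z]).
      by rewrite /= !inE negb_or xy xz yz.
    by move=> w; rewrite !inE mem_filter => /or3P[] /eqP->; apply/andP.
  have [B Bs hB] : exists2 B, B \in blocks s & perm_eq [:: B.1; B.2.1; B.2.2] [:: a; b; c].
    move: u; rewrite /= !inE negb_or andbT => /andP[/andP[ab ac] bc].
    apply: blocksP => //.
    - by apply: off h hq => //; rewrite /= !inE negb_or ab ac bc.
    - by apply: (off b a c) => //; rewrite /= ?inE ?negb_or ?bc ?ac 1?eq_sym ?ab // colC.
    - apply: (off c a b) => //; rewrite /= ?inE ?negb_or ?ab ?[c == _]eq_sym ?ac ?bc //.
        by rewrite colC colAC.
      rewrite colC; exact: col_trans ab h hq.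
    by rewrite /= !inE negb_or ab ac bc.
  apply/hasP; exists B => //.
  have uB : uniq [:: B.1; B.2.1; B.2.2] by rewrite (perm_uniq hB).
  have ne : B.1 != B.2.1 by move: uB; rewrite /= !inE negb_or -!andbA => /and3P[].
  have m1 : B.1 \in [:: a; b; c] by rewrite -(perm_mem hB) mem_head.
  have m2 : B.2.1 \in [:: a; b; c] by rewrite -(perm_mem hB) !inE eqxx orbT.
  exact: triple_col u h hq m1 m2 ne.
pose f q := nth (p, (p, p)) (blocks s) (find (fun B => col B.1 B.2.1 q) (blocks s)).
rewrite -(size_map f); apply: uniq_leq_size; last first.
  by move=> _ /mapP[q qu ->]; rewrite mem_nth // -has_find cov.
rewrite map_inj_in_uniq ?filter_uniq // => q q' qu qu' e.
have := nth_find (p, (p, p)) (cov q qu); have := nth_find (p, (p, p)) (cov q' qu').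
have := mem_nth (p, (p, p)) (eq_ind _ is_true (cov q qu) _ (has_find _ _)).
rewrite -/(f q) -/(f q') -e; case: (f q) => [a [b c]] /=.
case/(mem_blocks (filter_uniq _ uK)) => [[aS _ _]].
rewrite /= !inE negb_or => /andP[/andP[ab _] _] _ h' h.
(* A trisecant shared by two points of the line would be that line, but its points in [s] are off
   the line. *)
have := col_trans ab h h'; rewrite colC colAC => h1.
apply/eqP; apply: contraLR aS => qq'; rewrite mem_filter negb_and /= negbK.
move: qu qu'; rewrite !mem_filter => /andP[_ qP] /andP[_ qP'].
by rewrite (on_line_col (PL _ qP) (PL _ qP') qq' h1).
Qed.

(** * Arcs of at most 14 points contain 12 points with 17 trisecants *)

Lemma no4_count K x y s : no4 K -> uniq [:: x, y & s] ->
  {subset [:: x, y & s] <= K} -> count (col x y) s <= 1.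
Proof.
move=> h4 /=; rewrite inE negb_or => /and3P[/andP[xy xs] ys us] sub.
case E : (filter (col x y) s) => [|u [|v r]]; rewrite -size_filter E //.
have mf w : w \in filter (col x y) s -> [/\ w \in s, w \in K & col x y w].
  by rewrite mem_filter => /andP[-> ws]; split=> //; apply: sub; rewrite !inE ws !orbT.
have [us' uK hu] : [/\ u \in s, u \in K & col x y u] by apply: mf; rewrite E mem_head.
have [vs vK hv] : [/\ v \in s, v \in K & col x y v] by apply: mf; rewrite E !inE eqxx orbT.
have : uniq (filter (col x y) s) by rewrite filter_uniq.
rewrite E /= inE negb_or => /andP[/andP[uv _] _].
have := h4 x y u v; rewrite hv uK vK !sub ?inE ?eqxx ?orbT //= !inE => /(_ isT isT isT isT).
rewrite !negb_or xy uv.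
have ne z w : z \in s -> w \notin s -> w != z by move=> zs; apply: contraNneq => ->.
by rewrite !(ne _ _ us') ?(ne _ _ vs) //= => /(_ isT hu).
Qed.

Lemma sum_const (T : Type) (s : seq T) c : \sum_(x <- s) c = size s * c.
Proof. by rewrite big_const_seq count_predT iter_addn_0 mulnC. Qed.

Section Reduction.
Variable K : seq point.
Hypotheses (uK : uniq K) (h4 : no4 K).

Definition deg (s : seq point) x := bisecants x (rem x s).

Lemma perm_deg s x r : perm_eq s (x :: r) -> deg s x = bisecants x r.
Proof.
move=> h; apply: bisecants_perm; rewrite -(perm_cons x); apply: (perm_trans _ h).
by rewrite perm_sym perm_to_rem // (perm_mem h) mem_head.
Qed.

Lemma perm_two x y : x \in K -> y \in K -> x != y ->
  exists s, perm_eq K [:: x, y & s].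
Proof.
move=> xK yK xy; exists (rem y (rem x K)).
apply: perm_trans (perm_to_rem xK) _; rewrite perm_cons; apply: perm_to_rem.
by rewrite mem_rem_uniq // !inE eq_sym xy.
Qed.

Lemma trisecants_two x y s : perm_eq K [:: x, y & s] ->
  [/\ deg K x = count (col x y) s + bisecants x s, deg K y = count (col x y) s + bisecants y s
    & trisecants K = count (col x y) s + bisecants x s + bisecants y s + trisecants s].
Proof.
move=> h; split.
- by rewrite (perm_deg h) bisecants_cons.
- rewrite (@perm_deg _ y (x :: s)) ?bisecants_cons ?(eq_count (colC y x)) //.
  by apply: (perm_trans h); rewrite (perm_catCA [:: x] [:: y]).
by rewrite (trisecants_perm h) !trisecants_cons bisecants_cons; lia.
Qed.

(** Says that xy is a bisecant of K: y is left unpaired by the trisecants through x. *)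
Definition leaf x y := count (col x y) (rem y (rem x K)) == 0.

Lemma leaf_perm x y s : perm_eq K [:: x, y & s] -> leaf x y = (count (col x y) s == 0).
Proof.
move=> h; rewrite /leaf; congr (_ == 0); apply/permP.
rewrite -(perm_cons y) -(perm_cons x); apply: (perm_trans _ h); rewrite perm_sym.
have xK : x \in K by rewrite (perm_mem h) mem_head.
have yK : y \in rem x K.
  have := uK; rewrite (perm_uniq h) mem_rem_uniq //= !inE => /andP[].
  by rewrite negb_or (perm_mem h) !inE eqxx !orbT andbT eq_sym => /andP[].
by apply: perm_trans (perm_to_rem xK) _; rewrite perm_cons perm_to_rem.
Qed.

(** A trisecant through x pairs two of the other points, and no point is paired twice since no four
    points are collinear. *)
Lemma leaf_deg x : x \in K -> count (leaf x) (rem x K) + (deg K x).*2 = (size K).-1.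
Proof.
move=> xK; rewrite -(size_rem xK) /deg -sum_count_rem ?rem_uniq // count_sum -big_split /=.
rewrite -sum1_size; apply: eq_big_seq => y yr.
have : count (col x y) (rem y (rem x K)) <= 1.
  apply: (@no4_count K) => //.
    have := perm_uniq (perm_to_rem xK); rewrite uK => /esym /= /andP[xr ur].
    move: (perm_uniq (perm_to_rem yr)); rewrite ur => /esym /= ->; rewrite andbT inE negb_or.
    rewrite (contraNN (@mem_rem _ y _ x) xr) andbT.
    by apply: contraTneq yr => <-.
  move=> z; by rewrite (perm_mem (perm_to_rem xK)) !inE (perm_mem (perm_to_rem yr)) inE.
by rewrite /leaf; case: count => [|[]].
Qed.

Lemma sum_deg : \sum_(x <- K) deg K x = 3 * trisecants K.
Proof. exact: sum_bisecants_rem. Qed.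

Hypotheses (cK : complete K) (K14 : size K <= 14).

Lemma tangent_bound x : x \in K -> 16 + deg K x <= trisecants K.
Proof.
move=> xK; have hp := perm_to_rem xK.
(* There are 17 lines through x, and the other points of K, at most 13, cannot meet all of them. *)
have [i hi] : exists i, i \notin map (idx x) (rem x K).
  apply/existsP; apply: contraT => /existsPn h.
  have : #|{: option gf}| <= size (map (idx x) (rem x K)).
    by apply: leq_trans (card_size _); apply/subset_leq_card/subsetP => j _; have := h j; rewrite negbK.
  by rewrite card_option size_map size_rem // cardT enumT unlock /=; lia.
have h0 : count (on_line x i) (rem x K) = 0.
  apply/eqP; rewrite -leqn0 leqNgt -has_count; apply/hasPn => y yr.
  rewrite /on_line negb_or; apply/andP; split.
    by apply: contraTneq yr => ->; rewrite mem_rem_uniq // inE eqxx.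
  by apply: contraNneq hi => <-; apply: map_f.
have h1 : count (on_line x i) K = 1.
  by rewrite (permP hp) /= h0 /on_line eqxx.
have := line_bound (i := i) uK cK xK; rewrite h1 => /(_ isT).
have -> : trisecants (filter (predC (on_line x i)) K) = trisecants (rem x K).
  apply: trisecants_perm; apply: perm_trans (perm_filter _ hp) _.
  rewrite /= /on_line eqxx /=.
  rewrite (@eq_in_filter _ _ predT) ?filter_predT //.
  move=> y yr /=; apply/negP => hy.
  by have: has (on_line x i) (rem x K); [apply/hasP; exists y | rewrite has_count h0].
by rewrite (trisecants_perm hp) trisecants_cons /deg; lia.
Qed.

(** The 15 points off K of the bisecant xy need 15 different trisecants that avoid x and y. *)
Lemma bisecant_bound x y : x \in K -> y \in K -> x != y -> leaf x y ->
  15 + deg K x + deg K y <= trisecants K.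
Proof.
move=> xK yK xy; have [s hp] := perm_two xK yK xy.
rewrite (leaf_perm hp) => /eqP h0.
have [-> -> ->] := trisecants_two hp; rewrite h0.
have := uK; rewrite (perm_uniq hp) /= inE negb_or => /and3P[/andP[_ xs] ys us].
have hs z : z \in s -> on_line x (idx x y) z = col x y z.
  move=> zs; have zx : z != x by apply: contraNneq xs => <-.
  by rewrite /on_line (negPf zx) /= -idx_col // 1?eq_sym // eq_sym.
have h1 : count (on_line x (idx x y)) K = 2.
  by rewrite (permP hp) /= (eq_in_count hs) h0 /on_line !eqxx orbT.
have := line_bound (i := idx x y) uK cK xK; rewrite h1 => /(_ isT).
have -> : trisecants (filter (predC (on_line x (idx x y))) K) = trisecants s; last lia.
apply: trisecants_perm; apply: perm_trans (perm_filter _ hp) _.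
rewrite /= /on_line !eqxx orbT /= -/(on_line _ _).
rewrite (@eq_in_filter _ _ predT) ?filter_predT // => z zs.
apply/negP; rewrite -/(on_line _ _ z) hs // => hz.
by have: has (col x y) s; [apply/hasP; exists z | rewrite has_count h0].
Qed.

Lemma sum_le_const (T : eqType) (f : T -> nat) s c :
  (forall x, x \in s -> f x <= c) -> \sum_(x <- s) f x <= size s * c.
Proof.
elim: s => [|x s IH] h; first by rewrite big_nil.
rewrite big_cons mulSn leq_add ?h ?mem_head // IH // => y ys.
by rewrite h // inE ys orbT.
Qed.

Lemma sum_ge_const (T : eqType) (f : T -> nat) s c :
  (forall x, x \in s -> c <= f x) -> size s * c <= \sum_(x <- s) f x.
Proof.
elim: s => [|x s IH] h; first by rewrite big_nil.
rewrite big_cons mulSn leq_add ?h ?mem_head // IH // => y ys.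
by rewrite h // inE ys orbT.
Qed.

Lemma deg_half x : x \in K -> (deg K x).*2 <= (size K).-1.
Proof. by move=> xK; rewrite -(leaf_deg xK) leq_addl. Qed.

(** A trisecant through both x and y is counted in both degrees, whence the correction term. *)
Lemma delete2 x y : x \in K -> y \in K -> x != y ->
  exists s, [/\ perm_eq K [:: x, y & s] &
    trisecants s + deg K x + deg K y = trisecants K + count (col x y) (rem y (rem x K))].
Proof.
move=> xK yK xy; have [s hp] := perm_two xK yK xy; exists s; split=> //.
have [-> -> ->] := trisecants_two hp.
have -> : count (col x y) (rem y (rem x K)) = count (col x y) s; last lia.
apply/permP; rewrite -(perm_cons y) -(perm_cons x); apply: (perm_trans _ hp).
rewrite perm_sym; apply: perm_trans (perm_to_rem xK) _; rewrite perm_cons perm_to_rem //.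
by rewrite mem_rem_uniq // !inE eq_sym xy.
Qed.

(* Summing over y shows that all degrees are at least t - 20. As every point lies on an
   odd number of bisecants, bisecant_bound then gives degrees at most 5, and a point of
   degree 5 has three neighbours of degree at most t - 20: too few trisecants in total. *)
Lemma size14 : size K = 14 ->
  (forall x y s, perm_eq K [:: x, y & s] -> trisecants s <= 16) -> False.
Proof.
move=> n14 hs.
have lb x : x \in K -> trisecants K <= 20 + deg K x.
  move=> xK.
  have ur : uniq (rem x K) by rewrite rem_uniq.
  have sr : size (rem x K) = 13 by rewrite size_rem // n14.
  (* The hypothesis and [delete2] bound each term; the sum reads 13t + 2 deg x <= 208 + 13 deg x +
     (3t - deg x). *)
  have : \sum_(y <- rem x K) (trisecants K + count (col x y) (rem y (rem x K))) <=
         \sum_(y <- rem x K) (16 + deg K x + deg K y).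
    rewrite [X in X <= _]big_seq [X in _ <= X]big_seq; apply: leq_sum => y yr.
    have [yx yK] : y != x /\ y \in K by move: yr; rewrite mem_rem_uniq // inE => /andP[].
    have [|s [hp <-]] := delete2 xK yK; first by rewrite eq_sym.
    by have := hs _ _ _ hp; lia.
  rewrite !big_split /= sum_count_rem // !sum_const.
  have := sum_deg; rewrite (perm_big _ (perm_to_rem xK)) big_cons /=.
  by rewrite -/(deg K x) sr; lia.
have mate x : x \in K -> deg K x <= 5.
  move=> xK; have := leaf_deg xK; rewrite n14 => hl.
  have /hasP[y yr] : has (leaf x) (rem x K) by rewrite has_count; lia.
  have [yx yK] : y != x /\ y \in K by move: yr; rewrite mem_rem_uniq // inE => /andP[].
  move=> h; have := bisecant_bound xK yK _ h; rewrite eq_sym yx => /(_ isT).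
  by have := lb _ yK; lia.
(* If all degrees were at most 4, then 3t <= 56; [tangent_bound] would lower the degrees to at most
   2, so 3t <= 28, against t >= 16. *)
have [x xK x5] : exists2 x, x \in K & deg K x = 5.
  suff /hasP[x xK /eqP x5] : has (fun x => deg K x == 5) K by exists x.
  apply: contraT => /hasPn h.
  have le4 x : x \in K -> deg K x <= 4.
    by move=> xK; have := h _ xK; have := mate _ xK; rewrite /=; lia.
  have := sum_le_const le4; rewrite sum_deg n14 => h1.
  have le2 x : x \in K -> deg K x <= 2.
    by move=> xK; have := tangent_bound xK; lia.
  have := sum_le_const le2; rewrite sum_deg n14 => h2.
  have [x xK] : exists x, x \in K by move: n14; case: (K) => // x; exists x; rewrite mem_head.
  by have := tangent_bound xK; lia.
have := sum_deg; rewrite (perm_big _ (perm_to_rem xK)) big_cons /= x5.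
have sr : size (rem x K) = 13 by rewrite size_rem // n14.
have := leaf_deg xK; rewrite n14 x5 => cl.
(* Ten points share a trisecant with x and three do not, so 3t <= 5 + 10 * 5 + 3 (t - 20), which is
   absurd. *)
have : \sum_(y <- rem x K) deg K y <= \sum_(y <- rem x K) (5 * ~~ leaf x y + (trisecants K - 20) * leaf x y).
  rewrite [X in X <= _]big_seq [X in _ <= X]big_seq; apply: leq_sum => y yr.
  have [yx yK] : y != x /\ y \in K by move: yr; rewrite mem_rem_uniq // inE => /andP[].
  case h: (leaf x y); last by have := mate _ yK; rewrite /=; lia.
  have := bisecant_bound xK yK _ h; rewrite eq_sym yx => /(_ isT).
  by rewrite x5 /=; lia.
rewrite big_split /= -!big_distrr /= -!count_sum.
have := count_predC (leaf x) (rem x K); rewrite sr /predC /=.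
have := lb _ xK; rewrite x5; have := tangent_bound xK; rewrite x5.
have -> : count (leaf x) (rem x K) = 3 by lia.
set u := count (fun y => _) _; lia.
Qed.

Lemma core12 : exists s, [/\ uniq s, {subset s <= K}, size s = 12 & 17 <= trisecants s].
Proof.
have T x : x \in K -> deg K x <= trisecants K - 16 by move/tangent_bound; lia.
have T' := sum_le_const T; rewrite sum_deg in T'.
have D x : x \in K -> deg K x <= (size K).-1./2.
  by move=> xK; have := deg_half xK; lia.
have D' := sum_le_const D; rewrite sum_deg in D'.
have [x xK] : exists x, x \in K.
  case E : (K) => [|x s]; last by exists x; rewrite mem_head.
  by have := cK; rewrite E => /(_ InfV isT)[a [b [c [[aK _ _] _ _ _]]]].
have Tx := tangent_bound xK.
case: (ltnP (size K) 12) => n12.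
  (* For each n < 12, the upper bounds n (t - 16) and n floor((n - 1)/2) for 3t exclude each other,
     given t >= 16. *)
  exfalso; move: n12 T' D' Tx; case: (size K) => [|n] /=; first lia.
  do 11 (case: n => [|n] /=; first lia); lia.
have [n14|n14] := eqVneq (size K) 14.
  case h: (has (fun x => has (fun y => 16 < trisecants (rem y (rem x K))) (rem x K)) K).
    case/hasP: h => y yK /hasP[z zr h]; exists (rem z (rem y K)); split=> //.
    - by rewrite !rem_uniq.
    - by move=> w /mem_rem /mem_rem.
    - by rewrite !size_rem // n14.
  case: (size14 n14) => y z s hp; rewrite leqNgt; apply: contraFN h => h.
  have yK : y \in K by rewrite (perm_mem hp) mem_head.
  have hr : perm_eq (rem y K) (z :: s).
    by rewrite -(perm_cons y); apply: (perm_trans _ hp); rewrite perm_sym perm_to_rem.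
  have zr : z \in rem y K by rewrite (perm_mem hr) mem_head.
  apply/hasP; exists y => //; apply/hasP; exists z => //.
  rewrite (@trisecants_perm _ s) // -(perm_cons z); apply: (perm_trans _ hr).
  by rewrite perm_sym perm_to_rem.
have [n12'|n12'] := eqVneq (size K) 12; first by exists K; split=> //; move: T'; lia.
have n13 : size K = 13 by lia.
(* Otherwise every degree equals t - 16, so 3t = 13 (t - 16), although 10 does not divide 208. *)
have /hasP[y yK hy] : has (fun y => 17 + deg K y <= trisecants K) K.
  apply: contraT => /hasPn h.
  have T2 y : y \in K -> trisecants K - 16 <= deg K y by move=> yK; have := h y yK; rewrite /=; lia.
  by have := sum_ge_const T2; rewrite sum_deg; move: T'; rewrite n13; lia.
exists (rem y K); split; rewrite ?rem_uniq ?size_rem ?n13 //; first by move=> z /mem_rem.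
by move: hy; rewrite (trisecants_perm (perm_to_rem yK)) trisecants_cons /deg; lia.
Qed.
End Reduction.

(** A point e of degree 5 leaves a single point e' unpaired. The ten others still carry at least 17
    - 5 - 5 = 7 trisecants; one of them, acf, misses e, and each of its points has a partner on its
    line to e. *)
Lemma core_exists K : uniq K -> no4 K -> size K = 12 -> 17 <= trisecants K ->
  exists e a c f b d x,
  [/\ {subset [:: e; a; c; f; b; d; x] <= K}, col a c f /\ ~~ col e a c,
      uniq [:: a; c; f] /\ uniq [:: e; a; b], uniq [:: e; c; d] /\ uniq [:: e; f; x]
    & [/\ col e a b, col e c d & col e f x]].
Proof.
move=> uK h4 n12 t17.
have /hasP[e eK e5] : has (fun e => 5 <= deg K e) K.
  apply: contraT => /hasPn h.
  have le4 x : x \in K -> deg K x <= 4 by move=> xK; have := h x xK; rewrite /=; lia.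
  by have := sum_le_const le4; rewrite sum_deg // n12; lia.
have := leaf_deg uK h4 eK; rewrite n12 => cl.
have {}e5 : deg K e = 5 by lia.
have /hasP[e' e'r ee'] : has (leaf K e) (rem e K) by rewrite has_count; lia.
have [e'e e'K] : e' != e /\ e' \in K by move: e'r; rewrite mem_rem_uniq // inE => /andP[].
have [|s hp] := perm_two uK eK e'K; first by rewrite eq_sym.
have hr : perm_eq (rem e K) (e' :: s).
  by rewrite -(perm_cons e); apply: (perm_trans _ hp); rewrite perm_sym perm_to_rem.
have [] := trisecants_two uK hp; move: (ee'); rewrite (leaf_perm uK hp) => /eqP c0; rewrite c0 => d1 d2 d3.
have := deg_half uK h4 e'K; rewrite n12 => d4.
have nl z : z \in s -> exists w, [/\ w \in K, uniq [:: e; z; w] & col e z w].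
  move=> zs; have zr : z \in rem e K by rewrite (perm_mem hr) inE zs orbT.
  have : ~~ leaf K e z.
    apply/negP => h; have : 0 < count (leaf K e) s by rewrite -has_count; apply/hasP; exists z.
    by move: cl h; rewrite (permP hr (leaf K e)) /= ee' e5; move: (count _ s) => n; lia.
  rewrite /leaf -lt0n -has_count => /hasP[w wr h].
  have [ze zK] : z != e /\ z \in K by move: zr; rewrite mem_rem_uniq // inE => /andP[].
  move: wr; rewrite mem_rem_uniq ?rem_uniq // inE => /andP[wz].
  rewrite mem_rem_uniq // inE => /andP[we wK].
  by exists w; rewrite /= !inE negb_or ![e == _]eq_sym ze we [z == w]eq_sym wz.
have := t17; rewrite d3; case E : (blocks s) => [|[a [c f]] r]; first by rewrite {1}/trisecants E /=; lia.
move=> _.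
have us : uniq s by have := uK; rewrite (perm_uniq hp) /= => /and3P[].
have := @mem_blocks s a c f us; rewrite E mem_head => /(_ isT) [[as_ cs fs] u h].
have sK z : z \in s -> z \in K by move=> zs; rewrite (perm_mem hp) !inE zs !orbT.
have se z : z \in s -> z != e.
  have := uK; rewrite (perm_uniq hp) /= inE negb_or => /andP[/andP[_ +] _].
  by move=> es zs; apply: contraNneq es => <-.
have [b [bK ub hb]] := nl a as_; have [d [dK ud hd]] := nl c cs; have [x [xK ux hx]] := nl f fs.
exists e, a, c, f, b, d, x; split=> //.
  by apply/allP; rewrite /= eK bK dK xK !sK.
split=> //; apply/negP => he.
have : ~~ col a c e; last by rewrite colAC colC he.
have uq : uniq (rcons [:: a; c; f] e).
  by rewrite rcons_uniq u andbT !inE !negb_or ![e == _]eq_sym !se.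
exact: (h4 a c f e (sK _ as_) (sK _ cs) (sK _ fs) eK uq h).
Qed.

(** * The exhaustive search *)

(* Under call-by-value evaluation (vm_compute) [has] and [all] do not stop early. *)
Section Lazy.
Variables (T : Type) (a : T -> bool).
Fixpoint lazy_has (s : seq T) := if s is x :: s' then if a x then true else lazy_has s' else false.
Fixpoint lazy_all (s : seq T) := if s is x :: s' then if a x then lazy_all s' else false else true.
Lemma lazy_hasE s : lazy_has s = has a s.
Proof. by elim: s => //= x s ->; case: (a x). Qed.
Lemma lazy_allE s : lazy_all s = all a s.
Proof. by elim: s => //= x s ->; case: (a x). Qed.
End Lazy.

Definition mem_point x := lazy_has (point_eq x).
Definition omem i := lazy_has (oeq i).

Fixpoint hits (i : option gf) (sl : seq (option gf)) : nat :=
  if sl is j :: sl' then if oeq i j then (hits i sl').+1 else hits i sl' else 0.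

(** When x joins S, a point y keeps its number of bisecants if xy misses S, gains one if xy meets S
    once, and is dropped otherwise, as it would be a fourth point on a line. *)
Fixpoint split_bucket (x : point) sl (b : seq point) : seq point * seq point :=
  if b is y :: b' then
    let r := split_bucket x sl b' in
    match hits (idx x y) sl with
    | 0 => (y :: r.1, r.2)
    | 1 => (r.1, y :: r.2)
    | _ => r
    end
  else ([::], [::]).

(** [st] carries the points that keep their level; they are merged with those promoted from the
    bucket below, so the result has one bucket more. *)
Fixpoint update x sl (st : seq point) (bs : seq (seq point)) : seq (seq point) :=
  if bs is b :: bs' then
    let r := split_bucket x sl b in (r.2 ++ st) :: update x sl r.1 bs'
  else [:: st].

Fixpoint trim (bs : seq (seq point)) := if bs is [::] :: bs' then trim bs' else bs.

Definition discard x (b : seq point) := filter (fun y => ~~ point_eq x y) b.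

(* Bound on the sum of r values, at most n of which equal v, the others being smaller. *)
Definition gain r v n := if r <= n then r * v else n * v + (r - n) * v.-1.

(** Applied to the names of the lines joining x to S, it returns those of the bisecants of S through
    x. *)
Fixpoint doubled (sl : seq (option gf)) : seq (option gf) :=
  if sl is i :: sl' then if omem i sl' then i :: doubled sl' else doubled sl'
  else [::].

Fixpoint ocount x D (U : seq point) : nat :=
  if U is q :: U' then if omem (idx x q) D then (ocount x D U').+1 else ocount x D U'
  else 0.

Definition weight S U x := let D := doubled (map (idx x) S) in (ocount x D U).+1.

(* 1 plus the number of points of U covered by the bisecants of S through x; points in the
   last two buckets lie on at most one bisecant, whence the crude value 17 = 1 + 16. *)
Fixpoint weights S U (bs : seq (seq point)) : seq (point * nat) :=
  if bs is b :: bs' then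
    (if 1 < size bs' then map (fun x => (x, weight S U x)) b else map (fun x => (x, 17)) b)
      ++ weights S U bs'
  else [::].

Fixpoint max_weight (l : seq (point * nat)) :=
  if l is x :: l' then maxn x.2 (max_weight l') else 0.

Definition uncoverable S (U : seq point) x1 x2 :=
  let D1 := doubled (map (idx x1) S) in let D2 := doubled (map (idx x2) S) in
  let i := idx x1 x2 in
  lazy_has (fun q => if point_eq q x1 then false else if point_eq q x2 then false else
     let j := idx x1 q in if oeq j i then false else
     if omem j D1 then false else ~~ omem (idx x2 q) D2) U.

(* Two points outside S cover themselves, the points on bisecants of S through one of
   them, and the at most 15 other points of the line joining them. *)
Definition leaf_check S (unc : seq (seq point)) : bool :=
  let U := flatten unc in let n := size U in
  let W := weights S U unc in let m := max_weight W in
  (* If no point is left uncovered, S may itself be complete, and the check has to fail. *)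
  if 0 < n then
    lazy_all (fun a => if a.2 + m + 15 < n then true else
      lazy_all (fun b => if a.2 + b.2 + 15 < n then true else uncoverable S U a.1 b.1) W) W
  else false.

(* The adjacency lists only guide the search for forbidden cores: [forbidden_core]
   rechecks whatever they suggest. *)
Definition adjt := seq (point * seq (point * point)).

Fixpoint partner i (S : seq point) (sl : seq (option gf)) : option point :=
  match S, sl with
  | b :: S', j :: sl' => if oeq i j then Some b else partner i S' sl'
  | _, _ => None
  end.

(** These pairs are the trisecants created by adding the point x whose line names form [sl]. *)
Fixpoint closed_pairs (S : seq point) (sl : seq (option gf)) : seq (point * point) :=
  match S, sl with
  | a :: S', i :: sl' =>
    if partner i S' sl' is Some b then (a, b) :: closed_pairs S' sl' else closed_pairs S' sl'
  | _, _ => [::]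
  end.

Fixpoint lookup (p : point) (adj : adjt) : seq (point * point) :=
  if adj is (q, l) :: adj' then if point_eq p q then l else lookup p adj' else [::].

Fixpoint link q x (cl l : seq (point * point)) : seq (point * point) :=
  if cl is (a, b) :: cl' then
    if point_eq q a then (x, b) :: l else if point_eq q b then (x, a) :: l else link q x cl' l
  else l.

(** Each point is listed with the pairs completing it to a trisecant. A new pair comes first, and
    [forbidden_via] relies on this. *)
Definition add_adj x (cl : seq (point * point)) (adj : adjt) : adjt :=
  (x, cl) :: map (fun ql => (ql.1, link ql.1 x cl ql.2)) adj.

Definition gdiv a b := gmul a (ginv b).

(* The core consists of collinear a, c, f, a point e off their line, and points b, d, x
   on the lines ea, ec, ef. Scaling vectors so that a + c + f = 0 and b = e + b1 a,
   d = e + b2 c, x = e + b3 f, the invariants are b2 / b1 and b3 / b1. *)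
Definition ratios (e a c f b d x : point) : gf * gf :=
  let e := rep e in let a := rep a in let c := rep c in
  let f := rep f in let b := rep b in let d := rep d in let x := rep x in
  let fa := det e f c in let fc := det e a f in
  let b1 := gdiv (det e b c) (gmul (det b a c) fa) in
  let b2 := gdiv (det e a d) (gmul (det d a c) fc) in
  let b3 := gdiv (det e x c) (gmul (det x a c) fa) in
  (gdiv b2 b1, gdiv b3 b1).

Section Search.
Variable forbid : gf -> gf -> bool.

Definition is_core e a c f b d x : bool :=
  if col e a b then if col e c d then if col e f x then col a c f
  else false else false else false.

Definition forbidden_core S e a c f b d x : bool :=
  let '(d', x') := ratios e a c f b d x in
  if forbid d' x' then
    if is_core e a c f b d x then lazy_all (fun p => mem_point p S) [:: e; a; c; f; b; d; x] else false
  else false.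

(** The three pairs lie on lines through e; a core arises when a line joining a point of the first
    pair to one of the second passes through a point of the third. *)
Definition forbidden_lines S e (p1 p2 p3 : point * point) : bool :=
  lazy_has (fun uv : point * point * point * point => let: (u, u', v, v') := uv in
    let i := idx u v in
    if oeq i (idx u p3.1) then forbidden_core S e u v p3.1 u' v' p3.2 else
    if oeq i (idx u p3.2) then forbidden_core S e u v p3.2 u' v' p3.1 else false)
  [:: (p1.1, p1.2, p2.1, p2.2); (p1.1, p1.2, p2.2, p2.1);
      (p1.2, p1.1, p2.1, p2.2); (p1.2, p1.1, p2.2, p2.1)].

Fixpoint forbidden_pairs S e p1 (l : seq (point * point)) :=
  if l is p2 :: l' then
    if lazy_has (forbidden_lines S e p1 p2) l' then true else forbidden_pairs S e p1 l'
  else false.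

Fixpoint forbidden_at S e (l : seq (point * point)) :=
  if l is p1 :: l' then if forbidden_pairs S e p1 l' then true else forbidden_at S e l'
  else false.

Definition forbidden_via S adj e :=
  if lookup e adj is p1 :: l then forbidden_pairs S e p1 l else false.

(** A core containing the new point x either has x as its apex e, or has x on a trisecant through e;
    in the latter case e occurs in [cl] and the core uses the newest pair at e. *)
Definition forbidden x S cl adj : bool :=
  if forbidden_at S x cl then true else
  lazy_has (fun p : point * point => if forbidden_via S adj p.1 then true else forbidden_via S adj p.2) cl.

(* r points remain to be added to S, which has at most t trisecants. Candidates are kept
   in buckets: those in a bucket followed by v others lie on at most v bisecants of S.
   They are tried by decreasing v, and a candidate tried is excluded afterwards. *)
Fixpoint explore r S t (adj : adjt) (cands unc : seq (seq point)) {struct r} : bool :=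
  if r is r'.+1 then
    (fix over_buckets bs := if bs is b :: bs' then
        let v := size bs' in
        (fix over_bucket l := if l is x :: l' then
            (* A remaining point closes at most v bisecants of S, and each pair of remaining points
               lies on at most one further trisecant. The bound covers everything left in this
               bucket and the later ones, so failure ends the whole loop. *)
            if 17 <= t + gain r v (size l) + 'C(r, 2) then
              let sl := map (idx x) S in
              let cl := closed_pairs S sl in
              let adj' := add_adj x cl adj in
              let S' := x :: S in
              if (if forbidden x S' cl adj' then true
                  else explore r' S' (t + v) adj' (trim (update x sl [::] (l' :: bs')))
                    (trim (update x sl [::] (map (discard x) unc))))
              then over_bucket l' else false
            else true
          else over_buckets bs') b
      else true) cands
  else leaf_check S unc.
End Search.

Definition add_point x (st : seq point * adjt * seq (seq point)) :=
  let: (s, adj, bs) := st in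
  let sl := map (idx x) s in
  (x :: s, add_adj x (closed_pairs s sl) adj, trim (update x sl [::] (map (discard x) bs))).

Definition start (l : seq point) := foldr add_point ([::], [::], [:: points]) l.

Definition run forbid l :=
  let: (s, adj, bs) := start l in explore forbid (12 - size s) s (trisecants s) adj bs bs.

(** The points x, d, b, f, c, a, e in this order, with e = (0, 1, 0), a = (0, 0, 1), c = (1, 0, 0),
    f = a + c and b = e + a. The inverses come from normalising e + d c = (d, 1, 0) and e + x f =
    (x, 1, x). *)
Definition core d x :=
  [:: Aff k1 (ginv x); Inf (ginv d); Aff k0 k1; Aff k1 k0; Inf k0; Aff k0 k0; InfV].

(* The invariants (d, x) of cores fall into 15 classes under relabelling and Frobenius,
   numbered in the order in which they are excluded; 15 marks degenerate pairs. *)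
Definition core_class (d x : gf) : nat :=
  match d with k0 => 15
  | k1 => match x with k0 => 15 | k1 => 14 | k2 => 9 | k3 => 9 | k4 => 9 | k5 => 9 | k6 => 11 | k7 => 11 | k8 => 10 | k9 => 12 | ka => 10 | kb => 12 | kc => 10 | kd => 12 | ke => 12 | kf => 10 end
  | k2 => match x with k0 => 15 | k1 => 9 | k2 => 12 | k3 => 6 | k4 => 0 | k5 => 0 | k6 => 1 | k7 => 2 | k8 => 3 | k9 => 0 | ka => 4 | kb => 3 | kc => 5 | kd => 4 | ke => 1 | kf => 7 end
  | k3 => match x with k0 => 15 | k1 => 9 | k2 => 6 | k3 => 12 | k4 => 0 | k5 => 0 | k6 => 1 | k7 => 2 | k8 => 7 | k9 => 1 | ka => 5 | kb => 4 | kc => 4 | kd => 3 | ke => 0 | kf => 3 end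
  | k4 => match x with k0 => 15 | k1 => 9 | k2 => 0 | k3 => 0 | k4 => 12 | k5 => 6 | k6 => 2 | k7 => 1 | k8 => 4 | k9 => 3 | ka => 7 | kb => 1 | kc => 3 | kd => 0 | ke => 4 | kf => 5 end
  | k5 => match x with k0 => 15 | k1 => 9 | k2 => 0 | k3 => 0 | k4 => 6 | k5 => 12 | k6 => 2 | k7 => 1 | k8 => 5 | k9 => 4 | ka => 3 | kb => 0 | kc => 7 | kd => 1 | ke => 3 | kf => 4 end
  | k6 => match x with k0 => 15 | k1 => 11 | k2 => 1 | k3 => 1 | k4 => 2 | k5 => 2 | k6 => 11 | k7 => 13 | k8 => 5 | k9 => 5 | ka => 2 | kb => 1 | kc => 2 | kd => 1 | ke => 5 | kf => 5 end
  | k7 => match x with k0 => 15 | k1 => 11 | k2 => 2 | k3 => 2 | k4 => 1 | k5 => 1 | k6 => 13 | k7 => 11 | k8 => 2 | k9 => 1 | ka => 5 | kb => 5 | kc => 5 | kd => 5 | ke => 1 | kf => 2 end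
  | k8 => match x with k0 => 15 | k1 => 10 | k2 => 3 | k3 => 7 | k4 => 4 | k5 => 5 | k6 => 5 | k7 => 2 | k8 => 10 | k9 => 6 | ka => 8 | kb => 3 | kc => 8 | kd => 2 | ke => 4 | kf => 8 end
  | k9 => match x with k0 => 15 | k1 => 12 | k2 => 0 | k3 => 1 | k4 => 3 | k5 => 4 | k6 => 5 | k7 => 1 | k8 => 6 | k9 => 9 | ka => 2 | kb => 0 | kc => 3 | kd => 0 | ke => 7 | kf => 4 end
  | ka => match x with k0 => 15 | k1 => 10 | k2 => 4 | k3 => 5 | k4 => 7 | k5 => 3 | k6 => 2 | k7 => 5 | k8 => 8 | k9 => 2 | ka => 10 | kb => 6 | kc => 8 | kd => 4 | ke => 3 | kf => 8 end
  | kb => match x with k0 => 15 | k1 => 12 | k2 => 3 | k3 => 4 | k4 => 1 | k5 => 0 | k6 => 1 | k7 => 5 | k8 => 3 | k9 => 0 | ka => 6 | kb => 9 | kc => 4 | kd => 7 | ke => 0 | kf => 2 end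
  | kc => match x with k0 => 15 | k1 => 10 | k2 => 5 | k3 => 4 | k4 => 3 | k5 => 7 | k6 => 2 | k7 => 5 | k8 => 8 | k9 => 3 | ka => 8 | kb => 4 | kc => 10 | kd => 6 | ke => 2 | kf => 8 end
  | kd => match x with k0 => 15 | k1 => 12 | k2 => 4 | k3 => 3 | k4 => 0 | k5 => 1 | k6 => 1 | k7 => 5 | k8 => 2 | k9 => 0 | ka => 4 | kb => 7 | kc => 6 | kd => 9 | ke => 0 | kf => 3 end
  | ke => match x with k0 => 15 | k1 => 12 | k2 => 1 | k3 => 0 | k4 => 4 | k5 => 3 | k6 => 5 | k7 => 1 | k8 => 4 | k9 => 7 | ka => 3 | kb => 0 | kc => 2 | kd => 0 | ke => 9 | kf => 6 end
  | kf => match x with k0 => 15 | k1 => 10 | k2 => 7 | k3 => 3 | k4 => 5 | k5 => 4 | k6 => 5 | k7 => 2 | k8 => 8 | k9 => 4 | ka => 8 | kb => 2 | kc => 8 | kd => 3 | ke => 6 | kf => 10 end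
  end.

Definition class_reps :=
  [:: (k2, k4); (k2, k6); (k2, k7); (k2, k8); (k2, ka); (k2, kc); (k2, k3); (k2, kf);
      (k8, ka); (k1, k2); (k1, k8); (k1, k6); (k1, k9); (k6, k7); (k1, k1)].

Definition earlier_class (i : nat) d x := core_class d x < i.

(* The last core is the Fano plane PG(2,2), whose stabiliser is transitive on the points
   off its lines: its eighth point can be prescribed. *)
Definition start_of i : seq point :=
  let: (d, x) := nth (k1, k1) class_reps i in
  if i < 14 then core d x else Aff k2 k4 :: core d x.

Definition run_class i := run (earlier_class i) (start_of i).

Lemma run_classes : all run_class (iota 0 15).
Proof. by vm_compute. Qed.

(** * Soundness of the search *)

Lemma count_gt1P (T : eqType) (P : pred T) s : uniq s -> 1 < count P s ->
  exists u v, [/\ u \in s, v \in s, u != v, P u & P v].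
Proof.
move=> us; rewrite -size_filter; have := filter_uniq P us; have := mem_filter P.
move=> m u2 h; case E : (filter P s) u2 h => [|u [|v r]] //=.
rewrite inE negb_or => /andP[/andP[uv _] _] _; exists u, v.
have := m u s; have := m v s; rewrite E !inE !eqxx orbT /=.
by move=> /esym /andP[-> ->] /esym /andP[-> ->].
Qed.

Lemma count_gt1 (T : eqType) (P : pred T) s u v : u \in s -> v \in s -> u != v ->
  P u -> P v -> 1 < count P s.
Proof.
move=> us vs uv pu pv; rewrite -size_filter.
apply: (@uniq_leq_size _ [:: u; v]); first by rewrite /= inE uv.
by move=> z; rewrite !inE mem_filter => /orP[] /eqP->; apply/andP.
Qed.

Lemma point_eqE p q : point_eq p q = (p == q). Proof. by []. Qed.
Lemma mem_pointE x s : mem_point x s = (x \in s).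
Proof. by rewrite /mem_point lazy_hasE; elim: s => //= y s ->; rewrite inE. Qed.
Lemma omemE i s : omem i s = (i \in s).
Proof. by rewrite /omem lazy_hasE; elim: s => //= y s ->; rewrite inE oeqE. Qed.

Lemma hitsE x y s : y != x -> x \notin s ->
  hits (idx x y) (map (idx x) s) = count (col x y) s.
Proof.
move=> yx; elim: s => //= a s IH; rewrite inE negb_or => /andP[xa xs].
by rewrite oeqE idx_col // 1?eq_sym // IH //; case: col.
Qed.

Definition off_trisecants s y := all (fun B => ~~ col B.1 B.2.1 y) (blocks s).

Lemma off_trisecants_cons x s y : uniq (x :: s) -> y \notin x :: s ->
  off_trisecants (x :: s) y = (count (col x y) s <= 1) && off_trisecants s y.
Proof.
move=> /= /andP[xs us]; rewrite inE negb_or => /andP[yx ys].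
rewrite /off_trisecants /= all_cat; congr (_ && _).
have ne z : z \in s -> x != z by move=> zs; apply: contraNneq xs => ->.
apply/idP/idP.
  apply: contraTT; rewrite -ltnNge => /(count_gt1P us) [u [v [us' vs uv hu hv]]].
  have h : col x u v by apply: col_trans hu hv; rewrite eq_sym.
  apply/allPn; case/orP: (pairsP us' vs uv) => hp.
    exists (x, (u, v)); last by rewrite negbK /= colAC.
    by rewrite map_f // mem_filter /= h.
  exists (x, (v, u)); last by rewrite negbK /= colAC.
  by rewrite map_f // mem_filter /= colAC h.
move=> h; apply/allP => B /mapP[[u v]].
rewrite mem_filter /= => /andP[huv /(mem_pairs_uniq us)[us' vs uv]] -> /=.
apply: contraTN h => hu; rewrite -ltnNge; apply: (count_gt1 us' vs uv).
  by rewrite colAC.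
by rewrite colAC; apply: (col_trans (ne _ us') huv).
Qed.

Lemma no4_off_trisecants K s y : no4 K -> uniq (y :: s) -> {subset y :: s <= K} -> off_trisecants s y.
Proof.
move=> h4 /= /andP[ys us] sub; apply/allP => -[a [b c]] /(mem_blocks us)[[as_ bs cs] u h] /=.
have sK z : z \in s -> z \in K by move=> zs; rewrite sub // inE zs orbT.
apply: (h4 a b c y (sK _ as_) (sK _ bs) (sK _ cs) _ _ h); first by rewrite sub ?mem_head.
rewrite -[X in uniq X]/(rcons [:: a; b; c] y) rcons_uniq u andbT.
by apply: contra ys; rewrite !inE => /or3P[] /eqP->.
Qed.

Fixpoint in_buckets s y (bs : seq (seq point)) :=
  if bs is b :: bs' then (y \in b) && (bisecants y s <= size bs') || in_buckets s y bs'
  else false.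

Lemma in_buckets_lt s y bs : in_buckets s y bs -> bisecants y s < size bs.
Proof. by elim: bs => //= b bs IH /orP[/andP[_]|/IH] //; lia. Qed.

Lemma in_buckets_mem s y bs : in_buckets s y bs -> y \in flatten bs.
Proof. by elim: bs => //= b bs IH; rewrite mem_cat => /orP[/andP[->]|/IH ->] //; rewrite orbT. Qed.

Lemma in_buckets_trim s y bs : in_buckets s y (trim bs) = in_buckets s y bs.
Proof. by elim: bs => [|[|z b] bs IH]. Qed.

Lemma flatten_trim bs : flatten (trim bs) = flatten bs.
Proof. by elim: bs => [|[|z b] bs IH]. Qed.

Lemma in_buckets_discard s x y bs : y != x ->
  in_buckets s y (map (discard x) bs) = in_buckets s y bs.
Proof.
move=> yx; elim: bs => //= b bs ->; rewrite size_map mem_filter point_eqE [x == y]eq_sym.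
by rewrite yx.
Qed.

Lemma size_update x sl st bs : size (update x sl st bs) = (size bs).+1.
Proof. by elim: bs st => //= b bs IH st; rewrite IH. Qed.

Lemma split_bucket_mem x sl b y : y \in b ->
  match hits (idx x y) sl with
  | 0 => y \in (split_bucket x sl b).1
  | 1 => y \in (split_bucket x sl b).2
  | _ => true
  end.
Proof.
elim: b => //= z b IH; rewrite inE => /predU1P[->|/IH {IH}].
  by case: (hits _ sl) => [|[|n]] //=; rewrite mem_head.
case: (hits (idx x z) sl) => [|[|n]] /=; case: (hits (idx x y) sl) => [|[|n']] //=;
  by rewrite inE => ->; rewrite orbT.
Qed.

Lemma in_update s x y bs st : y != x -> x \notin s -> count (col x y) s <= 1 ->
  (y \in st) && (bisecants y (x :: s) <= size bs) || in_buckets s y bs ->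
  in_buckets (x :: s) y (update x (map (idx x) s) st bs).
Proof.
move=> yx xs h1; elim: bs st => [|b bs IH] st /=; first by rewrite !orbF.
rewrite size_update mem_cat => /or3P[/andP[-> ->]|/andP[yb yv]|yb]; first by rewrite orbT.
  have := split_bucket_mem x (map (idx x) s) yb; rewrite hitsE //.
  have : bisecants y (x :: s) = count (col x y) s + bisecants y s by rewrite bisecants_cons (eq_count (colC y x)).
  case: count h1 => [|[|]] // _ e h; first by rewrite IH ?orbT // h e yv.
  by rewrite h e /= ltnS yv.
by rewrite IH ?yb ?orbT.
Qed.

Lemma flatten_split x sl b :
  perm_eq ((split_bucket x sl b).1 ++ (split_bucket x sl b).2)
    (filter (fun y => hits (idx x y) sl <= 1) b).
Proof.
elim: b => //= z b IH; case: (hits _ sl) => [|[|n]] //=; first by rewrite perm_cons.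
by rewrite -cat_rcons -cats1 -catA perm_catCA perm_cons.
Qed.

Lemma flatten_update x sl st bs :
  perm_eq (flatten (update x sl st bs))
    (st ++ filter (fun y => hits (idx x y) sl <= 1) (flatten bs)).
Proof.
elim: bs st => [|b bs IH] st /=; first by rewrite cats0.
rewrite filter_cat; apply: (@perm_trans _ (((split_bucket x sl b).2 ++ st) ++
   ((split_bucket x sl b).1 ++ filter (fun y => hits (idx x y) sl <= 1) (flatten bs)))).
  by rewrite perm_cat2l.
rewrite -catA perm_catCA perm_cat2l catA perm_cat2r.
by apply: perm_trans (flatten_split x sl b); rewrite perm_catC.
Qed.

(** Unlike the candidates, from which tried points are removed, the uncovered points must be exact:
    they are counted, each must really need covering, and further points of K have to be among
    them. *)
Definition exact_unc s unc :=
  [/\ uniq (flatten unc),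
      forall y, y \in flatten unc -> (y \notin s) && off_trisecants s y
    & forall y, y \notin s -> off_trisecants s y -> in_buckets s y unc].

Lemma exact_add x s unc : uniq (x :: s) -> exact_unc s unc ->
  exact_unc (x :: s) (trim (update x (map (idx x) s) [::] (map (discard x) unc))).
Proof.
move=> uxs [u1 u2 u3]; have := uxs => /= /andP[xs us].
have fl : perm_eq (flatten (trim (update x (map (idx x) s) [::] (map (discard x) unc))))
  (filter (fun y => hits (idx x y) (map (idx x) s) <= 1) (filter (fun y => ~~ point_eq x y) (flatten unc))).
  by rewrite flatten_trim filter_flatten; apply: flatten_update.
split.
- by rewrite (perm_uniq fl) !filter_uniq.
- move=> y; rewrite (perm_mem fl) !mem_filter point_eqE => /and3P[h xy yu].
  have /andP[ys fy] := u2 y yu.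
  have yxs : y \notin x :: s by rewrite inE negb_or eq_sym xy.
  by rewrite yxs off_trisecants_cons // fy andbT -hitsE // eq_sym.
move=> y yxs; rewrite off_trisecants_cons // => /andP[h fy].
move: (yxs); rewrite inE negb_or => /andP[yx ys].
by rewrite in_buckets_trim in_update //= in_buckets_discard // u3.
Qed.

Lemma exact_start : exact_unc [::] [:: points].
Proof.
by split=> [|//|y _ _]; rewrite /= ?cats0 ?points_uniq // mem_points.
Qed.

Lemma mem_doubled (T : eqType) (f : T -> option gf) s u v : u \in s -> v \in s -> u != v ->
  f u = f v -> f u \in doubled (map f s).
Proof.
move=> + + + e; elim: s => //= a s IH; rewrite !inE omemE.
case/predU1P=> [ua|us]; case/predU1P=> [va|vs] uv; rewrite ?ua ?va in uv e *.
- by rewrite eqxx in uv.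
- have -> : f a \in map f s by rewrite e map_f.
  exact: mem_head.
- have -> : f a \in map f s by rewrite -e map_f.
  by rewrite e mem_head.
- by case: ifP => _; rewrite ?inE IH ?orbT.
Qed.

Lemma size_doubled x s : uniq s -> x \notin s -> size (doubled (map (idx x) s)) <= bisecants x s.
Proof.
elim: s => //= a s IH /andP[as_ us]; rewrite inE negb_or => /andP[xa xs].
rewrite bisecants_cons omemE; have := IH us xs; case: ifP => //= h; last lia.
suff : 0 < count (col x a) s by lia.
case/mapP: h => b bs e; rewrite -has_count; apply/hasP; exists b => //.
rewrite -idx_col ?e // 1?eq_sym //; by apply: contraNneq xs => ->.
Qed.

Lemma ocountE x D U : ocount x D U = count (fun q => idx x q \in D) U.
Proof. by elim: U => //= q U ->; rewrite omemE; case: (_ \in D). Qed.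

Lemma count_pencil x i U : uniq U -> count (fun q => (q != x) && (idx x q == i)) U <= 16.
Proof.
move=> uU; rewrite -(card_pencil x i) cardE -size_filter.
apply: uniq_leq_size; first by rewrite filter_uniq.
by move=> q; rewrite mem_filter mem_enum inE => /andP[].
Qed.

Lemma mem_weights s U bs x : uniq s -> uniq U -> x \notin s -> in_buckets s x bs ->
  exists2 w, (x, w) \in weights s U bs &
    count (fun q => (q != x) && (idx x q \in doubled (map (idx x) s))) U < w.
Proof.
move=> us uU xs; elim: bs => //= b bs IH /orP[/andP[xb xv]|/IH [w h1 h2]]; last first.
  by exists w => //; rewrite mem_cat h1 orbT.
case: ltnP => h.
  exists (weight s U x); first by rewrite mem_cat (map_f (fun x => (x, weight s U x))).
  by rewrite /weight ltnS ocountE; apply: sub_count => q /andP[].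
exists 17; first by rewrite mem_cat (map_f (fun x => (x, 17))).
have := leq_trans (size_doubled us xs) (leq_trans xv h).
case: (doubled _) => [|i [|]] // _.
  by rewrite (eq_count (a2 := pred0)) ?count_pred0 // => q; rewrite in_nil andbF.
rewrite ltnS; apply: leq_trans (count_pencil x i uU).
by apply: sub_count => q; rewrite inE.
Qed.

Lemma max_weightP l x w : (x, w) \in l -> w <= max_weight l.
Proof.
elim: l => //= -[y v] l IH; rewrite inE => /predU1P[[_ ->]|/IH]; first exact: leq_maxl.
by move=> h; apply: leq_trans h (leq_maxr _ _).
Qed.

Lemma size_cover5 (T : Type) (a b c d e : pred T) s :
  all (fun q => [|| a q, b q, c q, d q | e q]) s ->
  size s <= count a s + count b s + count c s + count d s + count e s.
Proof.
elim: s => //= q s IH /andP[h /IH {IH}].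
have : 0 < a q + b q + c q + d q + e q.
  by move: h; do 5 case: (_ q); rewrite // ?addn1 ?addnS.
lia.
Qed.

Section Leaf.
Variables (K s : seq point) (unc : seq (seq point)).
Hypotheses (uK : uniq K) (K14 : size K <= 14) (h4 : no4 K) (cK : complete K).
Hypotheses (us : uniq s) (sK : {subset s <= K}) (s12 : size s = 12).
Hypothesis ex : exact_unc s unc.
Let U := flatten unc.

(** At most 14 - 12 points of K are off s. There is at least one, as a point of U lies on no
    trisecant of s; if there is only one, then x1 = x2. *)
Lemma leaf_extra : 0 < size U -> exists x1 x2,
  [/\ x1 \in K, x2 \in K, x1 \notin s, x2 \notin s
    & forall z, z \in K -> [|| z \in s, z == x1 | z == x2]].
Proof.
move=> U0; case: ex => u1 u2 u3.
have : size (filter (fun z => z \notin s) K) <= 2.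
  have : size (filter (fun z => z \in s) K) = 12.
    rewrite -s12; apply/perm_size/uniq_perm; rewrite ?filter_uniq // => z.
    by rewrite mem_filter; case h: (z \in s); rewrite //= sK.
  have e : size (filter (fun z => z \in s) K) + size (filter (fun z => z \notin s) K) = size K.
    by rewrite !size_filter count_predC.
  lia.
have m z : (z \in filter (fun z => z \notin s) K) = (z \notin s) && (z \in K) by rewrite mem_filter.
case: (filter _ K) m => [|x1 [|x2 [|]]] // m _.
- have KS z : z \in K -> z \in s.
    by move=> zK; have := m z; rewrite zK andbT in_nil => /esym/negbFE.
  have [q qU] : exists q, q \in U by move: U0; case: U => // q r; exists q; rewrite mem_head.
  have /andP[qs /allP fq] := u2 q qU.
  have qK : q \notin K by apply: contra qs => /KS.
  have [a [b [c [[aK bK cK'] u h hq]]]] := cK qK.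
  have [B Bs hB] := blocksP (KS _ aK) (KS _ bK) (KS _ cK') u h.
  have := fq B Bs; rewrite (triple_col u h hq) //.
  + by rewrite -(perm_mem hB) mem_head.
  + by rewrite -(perm_mem hB) !inE eqxx orbT.
  have : uniq [:: B.1; B.2.1; B.2.2] by rewrite (perm_uniq hB).
  by rewrite /= inE negb_or => /andP[/andP[]].
- have := m x1; rewrite mem_head => /esym/andP[h1 h2].
  exists x1, x1; split=> // z zK; have := m z; rewrite zK andbT inE => ->.
  by case: (z \in s).
have := m x1; rewrite mem_head => /esym/andP[h1 h2].
have := m x2; rewrite !inE eqxx orbT => /esym/andP[h3 h5].
exists x1, x2; split=> // z zK; have := m z; rewrite zK andbT !inE => ->.
by case: (z \in s).
Qed.

(** A trisecant of K through q is not one of s, so it contains x1 or x2. If it contains both and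
    they differ, it is the line x1 x2; otherwise its other two points are in s. *)
Lemma leaf_cover x1 x2 q :
  x1 \in K -> x2 \in K -> x1 \notin s -> x2 \notin s ->
  (forall z, z \in K -> [|| z \in s, z == x1 | z == x2]) -> q \in U ->
  q != x1 -> q != x2 ->
  [\/ idx x1 q \in doubled (map (idx x1) s), idx x2 q \in doubled (map (idx x2) s)
    | x1 != x2 /\ idx x1 q = idx x1 x2].
Proof.
move=> x1K x2K x1s x2s Ks qU q1 q2.
case: ex => _ u2 _; have /andP[qs /allP fq] := u2 q qU.
have qK : q \notin K by apply/negP => /Ks; rewrite (negPf qs) (negPf q1) (negPf q2).
have [a [b [c [[aK bK cK'] u h hq]]]] := cK qK.
have P := triple_col u h hq.
pose T := [:: a; b; c].
have TK z : z \in T -> z \in K by rewrite !inE => /or3P[] /eqP->.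
have two x : x \in T -> x \notin s -> {in T, forall z, z != x -> z \in s} -> q != x ->
    idx x q \in doubled (map (idx x) s).
  move=> xT xs Ts qx.
  have : size (rem x T) = 2 by rewrite size_rem.
  have := rem_uniq x (u : uniq T); have := mem_rem_uniq x (u : uniq T).
  case: (rem x T) => [|y [|z [|]]] //= m; rewrite inE andbT => yz _.
  have [yx yT] : y != x /\ y \in T by have := m y; rewrite mem_head !inE => /esym /andP[].
  have [zx zT] : z != x /\ z \in T by have := m z; rewrite !inE eqxx orbT => /esym /andP[].
  have e w : w \in T -> w != x -> idx x w = idx x q.
    by move=> wT wx; apply/eqP; rewrite idx_col // P // eq_sym.
  rewrite -(e y) //; apply: (mem_doubled (Ts _ yT yx) (Ts _ zT zx) yz).
  by rewrite !e.
have [x1T|x1T] := boolP (x1 \in T).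
  have [/andP[x2T x12]|] := boolP ((x2 \in T) && (x1 != x2)).
    apply: Or33; split=> //; apply/esym/eqP; rewrite idx_col ?P //.
    by rewrite eq_sym.
  move=> h2; apply: Or31; apply: two => // z zT zx1.
  have := Ks z (TK z zT); rewrite (negPf zx1) orFb => /orP[//|/eqP e].
  by move: h2; rewrite -e zT eq_sym zx1.
have [x2T|x2T] := boolP (x2 \in T).
  apply: Or32; apply: two => // z zT zx2.
  have := Ks z (TK z zT); rewrite (negPf zx2) orbF => /orP[//|/eqP e].
  by rewrite -e zT in x1T.
have Ts z : z \in T -> z \in s.
  move=> zT; have := Ks z (TK z zT) => /or3P[//|/eqP e|/eqP e].
    by rewrite -e zT in x1T.
  by rewrite -e zT in x2T.
have [||| B Bs hB] := @blocksP s a b c _ _ _ u h; rewrite ?Ts ?inE ?eqxx ?orbT //.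
have := fq B Bs; rewrite P //.
+ by rewrite -(perm_mem hB) mem_head.
+ by rewrite -(perm_mem hB) !inE eqxx orbT.
have : uniq [:: B.1; B.2.1; B.2.2] by rewrite (perm_uniq hB).
by rewrite /= inE negb_or => /andP[/andP[]].
Qed.

Lemma leaf_sound : leaf_check s unc -> False.
Proof.
rewrite /leaf_check -/U; case: ifP => // U0.
have [x1 [x2 [x1K x2K x1s x2s Ks]]] := leaf_extra U0.
have cov q := leaf_cover x1K x2K x1s x2s Ks (q := q).
case: (ex) => u1 u2 u3.
have inU x : x \in K -> x \notin s -> in_buckets s x unc.
  move=> xK xs; apply: u3 => //; apply: (no4_off_trisecants h4); rewrite /= ?xs //.
  by move=> z; rewrite inE => /predU1P[->|/sK].
have [w1 W1 h1] := mem_weights us u1 x1s (inU _ x1K x1s).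
have [w2 W2 h2] := mem_weights us u1 x2s (inU _ x2K x2s).
(* The strict inequalities [h1] and [h2] leave room for x1 and x2 themselves; the 15 stands for the
   points of the line x1 x2 other than these two. *)
have bound : size U <= w1 + w2 + 15.
  pose P3 q := [&& x1 != x2, q != x1, q != x2 & idx x1 q == idx x1 x2].
  pose P1 q := (q != x1) && (idx x1 q \in doubled (map (idx x1) s)).
  pose P2 q := (q != x2) && (idx x2 q \in doubled (map (idx x2) s)).
  have c3 : count P3 U <= 15.
    have [x12|x12] := eqVneq x1 x2.
      by rewrite (eq_count (a2 := pred0)) ?count_pred0 // => q; rewrite /P3 x12 eqxx.
    rewrite -ltnS; apply: leq_trans (count_pencil x1 (idx x1 x2) u1).
    have x2U : x2 \in U by apply: in_buckets_mem (inU _ x2K x2s).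
    rewrite !(permP (perm_to_rem x2U)) /= eqxx [x2 == x1]eq_sym x12 /P3 eqxx !andbF add0n.
    by rewrite add1n ltnS; apply: sub_count => q /and4P[_ -> _ ->].
  have c1 x : count (pred1 x) U <= 1 by rewrite count_uniq_mem // leq_b1.
  have : size U <= count (pred1 x1) U + count (pred1 x2) U + count P1 U + count P2 U + count P3 U.
    have : all (fun q => [|| q == x1, q == x2, P1 q, P2 q | P3 q]) U.
      apply/allP => q qU; rewrite /P1 /P2 /P3.
      have [//|q1] := eqVneq q x1; have [//|q2] := eqVneq q x2.
      by case: (cov q qU q1 q2) => [->|->|[-> ->]]; rewrite ?eqxx /= ?orbT.
    exact: size_cover5.
  have := c1 x1; have := c1 x2.
  have : count P1 U < w1 := h1; have : count P2 U < w2 := h2.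
  by move: c3; move: (count P1 U) (count P2 U) (count P3 U); lia.
rewrite lazy_allE => /allP /(_ _ W1) /=.
case: ifP => [h|_]; first by have := max_weightP W2; rewrite -/U; lia.
rewrite lazy_allE => /allP /(_ _ W2) /=.
case: ifP => [h|_]; first by lia.
rewrite /uncoverable lazy_hasE => /hasP[q qU]; rewrite !point_eqE.
case: eqP => // /eqP q1; case: eqP => // /eqP q2; rewrite oeqE !omemE.
case: eqP => // q3; case: ifP => // q4 q5.
by case: (cov q qU q1 q2) => [|h|[_ h]]; [rewrite q4|rewrite h in q5|].
Qed.
End Leaf.

Lemma bisecants_cat_bound K y r s : no4 K -> uniq (y :: r ++ s) -> {subset y :: r ++ s <= K} ->
  bisecants y (r ++ s) <= bisecants y s + size r.
Proof.
move=> h4; elim: r => [|b r IH] /=; first by rewrite addn0.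
rewrite inE negb_or -!andbA => /and4P[yb yrs brs urs] sub; rewrite bisecants_cons addnS -add1n.
have h1 : count (col y b) (r ++ s) <= 1.
  by apply: (no4_count h4) => //=; rewrite inE negb_or yb yrs brs.
apply: leq_add => //; apply: IH; rewrite /= ?yrs // => z zs; apply: sub; move: zs; rewrite !inE.
by case/predU1P=> [->|->]; rewrite ?eqxx ?orbT.
Qed.

(** A trisecant with at least two points in r is charged to a pair of points of r, and no pair is
    charged twice. *)
Lemma trisecants_cat_bound K r s : no4 K -> uniq (r ++ s) -> {subset r ++ s <= K} ->
  trisecants (r ++ s) <= trisecants s + \sum_(y <- r) bisecants y s + 'C(size r, 2).
Proof.
move=> h4; elim: r => [|y r IH]; first by rewrite big_nil !addn0.
rewrite cat_cons => u sub; rewrite trisecants_cons big_cons /= binS bin1.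
have hc := bisecants_cat_bound h4 u sub.
have sub' : {subset r ++ s <= K} by move=> z zr; apply: sub; rewrite inE zr orbT.
move: u => /= /andP[_ u]; apply: leq_trans (leq_add hc (IH u sub')) _.
by rewrite leq_eqVlt; apply/orP/or_introl/eqP; ring.
Qed.

Lemma sum_gain (T : eqType) (f : T -> nat) r l v : uniq r ->
  (forall y, y \in r -> (y \in l) && (f y <= v) || (f y < v)) ->
  \sum_(y <- r) f y <= gain (size r) v (size l).
Proof.
move=> ur h.
have m1 : count (fun y => y \in l) r <= size l.
  rewrite -size_filter; apply: uniq_leq_size; first by rewrite filter_uniq.
  by move=> y; rewrite mem_filter => /andP[].
have m2 := count_size (fun y => y \in l) r.
have : \sum_(y <- r) f y <= count (fun y => y \in l) r * v + (size r - count (fun y => y \in l) r) * v.-1.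
  elim: (r) h => [|y r' IH] h; first by rewrite big_nil.
  rewrite big_cons /=; have {}IH : \sum_(j <- r') f j <= _ := IH (fun z zr => h z (@mem_behead _ (y :: r') z zr)).
  have m3 := count_size (fun y => y \in l) r'.
  have := h y (mem_head _ _); case: (y \in l) => /= hy.
    rewrite add1n subSS mulSn -addnA leq_add //.
    by case/orP: hy => // /ltnW.
  by rewrite add0n subSn // mulSn addnCA leq_add // -ltnS prednK //; case: (v) hy.
move=> h'; apply: leq_trans h' _; rewrite /gain.
move: (count _ r) (size r) (size l) m1 m2 {h} => m n k m1 m2.
case: v => [|v] /=; first by rewrite !muln0 !if_same.
have e i : i <= n -> i * v.+1 + (n - i) * v = i + n * v.
  by move=> le; rewrite -[in RHS](subnKC le) mulnDl mulnS addnA.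
by case: (leqP n k) => h; rewrite !e ?mulnS ?leq_add // ltnW.
Qed.

Section Sound.
Variable forbid : gf -> gf -> bool.

Definition avoids (s : seq point) := forall e a c f b d x,
  {subset [:: e; a; c; f; b; d; x] <= s} -> is_core e a c f b d x ->
  ~~ forbid (ratios e a c f b d x).1 (ratios e a c f b d x).2.

Lemma forbidden_coreP s e a c f b d x : avoids s -> forbidden_core forbid s e a c f b d x = false.
Proof.
move=> av; rewrite /forbidden_core.
case E : (ratios _ _ _ _ _ _ _) => [d' x']; case: ifP => // hf; case: ifP => // hc.
rewrite lazy_allE; apply/negP => /allP h.
have := av e a c f b d x _ hc; rewrite E /= hf => H; suff: false by []; apply: H => z zs.
by rewrite -mem_pointE h.
Qed.

Lemma forbidden_pairsP s e p l : avoids s -> forbidden_pairs forbid s e p l = false.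
Proof.
move=> av; elim: l => //= p2 l ->; rewrite lazy_hasE.
suff -> : has (forbidden_lines forbid s e p p2) l = false by [].
apply/negP => /hasP[p3 _]; rewrite /forbidden_lines lazy_hasE => /hasP[[[[u u'] v] v'] _].
by rewrite !forbidden_coreP //; case: ifP => //; case: ifP.
Qed.

Lemma forbidden_sound x s cl adj : avoids s -> forbidden forbid x s cl adj = false.
Proof.
move=> av; rewrite /forbidden.
have -> : forbidden_at forbid s x cl = false by elim: cl => //= p cl IH; rewrite forbidden_pairsP.
have via e : forbidden_via forbid s adj e = false.
  by rewrite /forbidden_via; case: lookup => // p l; rewrite forbidden_pairsP.
by rewrite lazy_hasE; apply/negP => /hasP[p _]; rewrite !via.
Qed.

Variables K K' : seq point.
Hypotheses (uK : uniq K) (K14 : size K <= 14) (h4 : no4 K) (cK : complete K).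
Hypotheses (uK' : uniq K') (sK' : {subset K' <= K}) (n12 : size K' = 12) (t17 : 17 <= trisecants K').
Hypothesis av : avoids K'.

(** The nested inductions follow the three loops. Throughout, every point of K' outside s lies in
    the rest of the current bucket or, with its bisecant bound, in a later one. *)
Lemma explore_sound r s t adj cands unc : uniq s -> {subset s <= K'} ->
  size s + r = 12 -> trisecants s <= t ->
  (forall y, y \in K' -> y \notin s -> in_buckets s y cands) ->
  exact_unc s unc -> explore forbid r s t adj cands unc -> False.
Proof.
elim: r s t adj cands unc => [|r IH] s t adj cands unc us sub sr st hc ex /=.
  have s12 : size s = 12 by rewrite -sr addn0.
  exact: (leaf_sound uK K14 h4 cK us (fun z zs => sK' (sub z zs)) s12 ex).
have uR : uniq (filter (fun y => y \notin s) K') by rewrite filter_uniq.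
have pR : perm_eq K' (filter (fun y => y \notin s) K' ++ s).
  rewrite perm_sym; apply: (perm_trans _ (permEl (perm_filterC (fun y => y \in s) K'))).
  rewrite perm_catC; apply: perm_cat; last by rewrite perm_refl.
  apply: uniq_perm; rewrite ?filter_uniq // => z; rewrite mem_filter.
  by case h: (z \in s) => //=; rewrite sub.
have nR : size (filter (fun y => y \notin s) K') = r.+1.
  by have := perm_size pR; rewrite size_cat n12; lia.
have mR y : y \in filter (fun y => y \notin s) K' -> y \in K' /\ y \notin s.
  by rewrite mem_filter => /andP[].
elim: cands hc => [|b bs IHb] hc.
  case: (filter _ K') nR mR => // y R _ m; have [yK ys] := m y (mem_head _ _).
  by have := hc y yK ys.
rewrite /=; set v := size bs.
have {hc} : forall y, y \in K' -> y \notin s -> (y \in b) && (bisecants y s <= v) || in_buckets s y bs.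
  by move=> y yK ys; have := hc y yK ys.
move: b => l; elim: l => [|x l IHl] hl; first by apply: IHb => y yK ys; have := hl y yK ys.
set test := (17 <= _); case: ifP => ht; last first.
  move=> _; move/negP: ht; apply; rewrite /test.
  have bR := @trisecants_cat_bound K (filter (fun y => y \notin s) K') s h4 _ _.
  apply: leq_trans t17 _; rewrite (trisecants_perm pR); apply: leq_trans (bR _ _) _.
  - by rewrite -(perm_uniq pR).
  - by move=> z; rewrite -(perm_mem pR) => /sK'.
  rewrite nR leq_add2r leq_add // -nR; apply: sum_gain => // y /mR[yK ys].
  by case/orP: (hl y yK ys) => [->//|/in_buckets_lt ->]; rewrite orbT.
(* If x is in K', the recursive call gives the contradiction; if not, dropping x from the bucket
   preserves the invariant. *)
case: ifP => // h1 h2; apply: IHl h2 => y yK ys.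
have := hl y yK ys; rewrite inE; case: eqP => // e _; subst y.
exfalso; move: h1.
have cx : bisecants x s <= v.
  by have := hl x yK ys; case/orP=> [/andP[]//|/in_buckets_lt/ltnW].
have sub' : {subset x :: s <= K'} by move=> z; rewrite inE => /predU1P[->|/sub].
rewrite forbidden_sound; last first.
  by move=> *; apply: av => // z zs; apply: sub'; auto.
have uxs : uniq (x :: s) by rewrite /= ys.
apply: IH => //.
- by rewrite /= addSn -addnS.
- by rewrite trisecants_cons addnC leq_add.
- move=> y yK'; rewrite inE negb_or => /andP[yx ys'].
  rewrite -[X in in_buckets _ _ X]/(trim (update x (map (idx x) s) [::] (l :: bs))).
  rewrite in_buckets_trim in_update //=.
    apply: (@no4_count K) => //; first by rewrite /= inE negb_or eq_sym yx ys ys' us.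
    by move=> z; rewrite !inE => /or3P[/eqP->|/eqP->|/sub] => [||/sK' //]; exact: sK'.
  have := hl y yK' ys'; rewrite inE (negPf yx) //.
exact: exact_add.
Qed.

Lemma startP l : uniq l -> (start l).1.1 = l /\ exact_unc l (start l).2.
Proof.
elim: l => [|x l IH]; first by split=> //; apply: exact_start.
move=> u; have /= /andP[_ /IH {IH}] := u; rewrite /start /= -/(start l).
case: (start l) => [[s adj] bs] /= [-> ex]; split=> //; exact: exact_add.
Qed.

Lemma run_sound l : uniq l -> {subset l <= K'} -> run forbid l -> False.
Proof.
move=> ul sub; rewrite /run; have := startP ul.
case: (start l) => [[s adj] bs] /= [-> ex]; apply: explore_sound => //.
  by rewrite subnKC // -n12 uniq_leq_size.
move=> y yK yl; case: ex => _ _; apply=> //.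
apply: (no4_off_trisecants h4); rewrite /= ?yl // => z; rewrite inE => /predU1P[->|/sub]; exact: sK'.
Qed.
End Sound.

(** * Collineations *)

Local Open Scope ring_scope.

Lemma det_mulmx (R : comPzRingType) (a1 a2 a3 b1 b2 b3 c1 c2 c3 u1 u2 u3 v1 v2 v3 w1 w2 w3 : R) :
  let det x1 x2 x3 y1 y2 y3 z1 z2 z3 :=
    x1 * (y2 * z3 - y3 * z2) + x2 * (y3 * z1 - y1 * z3) + x3 * (y1 * z2 - y2 * z1) in
  let dot x1 x2 x3 y1 y2 y3 := x1 * y1 + (x2 * y2 + x3 * y3) in
  det (dot a1 a2 a3 u1 u2 u3) (dot b1 b2 b3 u1 u2 u3) (dot c1 c2 c3 u1 u2 u3)
      (dot a1 a2 a3 v1 v2 v3) (dot b1 b2 b3 v1 v2 v3) (dot c1 c2 c3 v1 v2 v3)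
      (dot a1 a2 a3 w1 w2 w3) (dot b1 b2 b3 w1 w2 w3) (dot c1 c2 c3 w1 w2 w3) =
  det a1 a2 a3 b1 b2 b3 c1 c2 c3 * det u1 u2 u3 v1 v2 v3 w1 w2 w3.
Proof. by move=> det dot; rewrite /det /dot; ring. Qed.

Definition dot (u v : vec) : gf :=
  let: (u1, u2, u3) := u in let: (v1, v2, v3) := v in
  gadd (gmul u1 v1) (gadd (gmul u2 v2) (gmul u3 v3)).
Definition scale (k : gf) (v : vec) : vec :=
  let: (v1, v2, v3) := v in (gmul k v1, gmul k v2, gmul k v3).
Definition cross (u v : vec) : vec :=
  let: (u1, u2, u3) := u in let: (v1, v2, v3) := v in
  (gadd (gmul u2 v3) (gmul u3 v2), gadd (gmul u3 v1) (gmul u1 v3),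
   gadd (gmul u1 v2) (gmul u2 v1)).
Definition app (m : vec * vec * vec) (v : vec) : vec :=
  (dot m.1.1 v, dot m.1.2 v, dot m.2 v).
Definition norm (v : vec) : point :=
  let: (x, y, z) := v in
  if is0 z then if is0 x then InfV else Inf (gdiv y x) else Aff (gdiv x z) (gdiv y z).

Lemma det_app m u v w :
  det (app m u) (app m v) (app m w) = det m.1.1 m.1.2 m.2 * det u v w.
Proof.
case: m u v w => [[[[a1 a2] a3] [[b1 b2] b3]] [[c1 c2] c3]].
move=> [[u1 u2] u3] [[v1 v2] v3] [[w1 w2] w3].
rewrite /app /dot !detE; exact: det_mulmx.
Qed.

Lemma det_scale k l m u v w :
  det (scale k u) (scale l v) (scale m w) = k * l * m * det u v w.
Proof.
case: u v w => [[u1 u2] u3] [[v1 v2] v3] [[w1 w2] w3].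
rewrite /scale !detE !gmulE; ring.
Qed.

Lemma dot_cross u v w : dot (cross u v) w = det u v w.
Proof.
case: u v w => [[u1 u2] u3] [[v1 v2] v3] [[w1 w2] w3].
rewrite detE /dot /cross !gmulE.
have B (a b : gf) : gadd a b = a - b by [].
have D (a b : gf) : gadd a b = a + b by [].
rewrite [gadd (u2 * v3) _]B [gadd (u3 * v1) _]B [gadd (u1 * v2) _]B !D; ring.
Qed.

Lemma dot_scale k u v : dot (scale k u) v = k * dot u v.
Proof.
case: u v => [[u1 u2] u3] [[v1 v2] v3]; rewrite /dot /scale !gmulE.
have D (a b : gf) : gadd a b = a + b by [].
by rewrite !D; ring.
Qed.

Lemma det_cross u v w : det (cross u v) (cross v w) (cross w u) = det u v w ^+ 2.
Proof.
case: u v w => [[u1 u2] u3] [[v1 v2] v3] [[w1 w2] w3].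
have B (a b : gf) : gadd a b = a - b by [].
by rewrite /cross !detE !B !gmulE; ring.
Qed.

Lemma rep_norm v : v != (k0, k0, k0) -> exists2 k, k != 0 & rep (norm v) = scale k v.
Proof.
case: v => [[x y] z] v0; rewrite /norm !is0E.
have [z0|z0] /= := eqVneq z 0; last first.
  by exists z^-1; rewrite ?invr_eq0 // /rep /scale /gdiv !gmulE ginvE mulVf // ![_ * z^-1]mulrC.
have [x0|x0] /= := eqVneq x 0; last first.
  exists x^-1; rewrite ?invr_eq0 // /rep /scale /gdiv !gmulE ginvE mulVf // z0.
  by rewrite mulr0 mulrC.
have y0 : y != 0 by apply: contraNneq v0 => ->; rewrite x0 z0.
by exists y^-1; rewrite ?invr_eq0 // /rep /scale !gmulE x0 z0 mulVf // mulr0.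
Qed.

Lemma col_norm u v w : u != (k0, k0, k0) -> v != (k0, k0, k0) -> w != (k0, k0, k0) ->
  col (norm u) (norm v) (norm w) = (det u v w == 0).
Proof.
move=> /rep_norm[k kn eu] /rep_norm[l ln ev] /rep_norm[m mn ew].
by rewrite /col eu ev ew det_scale -[k0]/(0 : gf) !mulf_eq0 (negPf kn) (negPf ln) (negPf mn).
Qed.

Lemma exists_noncol p q : p != q -> exists r, ~~ col p q r.
Proof.
move=> pq; apply/existsP; apply: contraT => /existsPn h.
have : (#|{: point}| <= #|p |: [set r | r != p & idx p r == idx p q]|)%N.
  apply: subset_leq_card; apply/subsetP => r _; rewrite !inE.
  have [//|rp] /= := eqVneq r p; rewrite idx_col // 1?eq_sym // -colAC.
  by have := h r; rewrite negbK.
by rewrite card_point cardsU1 card_pencil; case: (_ \notin _).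
Qed.

Definition collineation (tau : point -> point) := forall p q r, col (tau p) (tau q) (tau r) = col p q r.

Lemma collineation_inj tau : collineation tau -> injective tau.
Proof.
move=> ct p q e; apply/eqP; apply: contraT => /exists_noncol[r].
by rewrite -ct e col_dup.
Qed.

Definition linear_map m p := norm (app m (rep p)).

Lemma linear_collineation m : det m.1.1 m.1.2 m.2 != 0 -> collineation (linear_map m).
Proof.
move=> m0.
(* Complete p to a non-collinear triple: a zero image would make the product of the two determinants
   vanish. *)
have nz p : app m (rep p) != (k0, k0, k0).
  have [q pq] : exists q, p != q.
    by have [] := eqVneq p InfV => [->|?]; [exists (Inf k0)|exists InfV].
  have [r] := exists_noncol pq; apply: contraNneq => e.
  rewrite /col; have := det_app m (rep p) (rep q) (rep r); rewrite e.
  have -> v w : det (k0, k0, k0) v w = 0 by case: v w => [[? ?] ?] [[? ?] ?].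
  by move/esym/eqP; rewrite mulf_eq0 (negPf m0).
move=> p q r; rewrite /linear_map col_norm // det_app mulf_eq0 (negPf m0) //.
Qed.

Definition frob (p : point) :=
  match p with Aff x y => Aff (gmul x x) (gmul y y) | Inf m => Inf (gmul m m) | InfV => InfV end.

Lemma gf_sqrD (a b : gf) : (a + b) * (a + b) = a * a + b * b.
Proof. by rewrite mulrDl !mulrDr [b * a]mulrC -addrA (addrA (a * b)) gaddrr add0r. Qed.

(** In characteristic 2, squaring the coordinates squares the determinant. *)
Lemma frob_collineation : collineation frob.
Proof.
pose s (v : vec) : vec := let: (x, y, z) := v in (gmul x x, gmul y y, gmul z z).
have e p : rep (frob p) = s (rep p) by case: p.
have h u v w : det (s u) (s v) (s w) = det u v w * det u v w.
  case: u v w => [[u1 u2] u3] [[v1 v2] v3] [[w1 w2] w3].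
  have D (a b : gf) : gadd a b = a + b by [].
  have M (a b : gf) : (a * b) * (a * b) = (a * a) * (b * b) by rewrite mulrACA.
  by rewrite /s /det !gmulE !D !(gf_sqrD, M).
by move=> p q r; rewrite /col !e h -[k0]/(0 : gf) mulf_eq0 orbb.
Qed.

Local Close Scope ring_scope.

(** * Classes of cores up to collineation *)

Record small_arc (K' K : seq point) : Prop := SmallArc {
  small_arc_uniq : uniq K; small_arc_size : size K <= 14; small_arc_no4 : no4 K; small_arc_complete : complete K;
  small_arc_uniq' : uniq K'; small_arc_sub : {subset K' <= K}; small_arc_size' : size K' = 12;
  small_arc_tt : 17 <= trisecants K' }.

Lemma pairs_map (S T : Type) (f : S -> T) s : pairs (map f s) = map (fun p => (f p.1, f p.2)) (pairs s).
Proof. by elim: s => //= a s ->; rewrite map_cat -!map_comp. Qed.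

Lemma trisecants_map tau s : collineation tau -> trisecants (map tau s) = trisecants s.
Proof.
move=> ct; elim: s => //= a s IH; rewrite !trisecants_cons IH; congr (_ + _).
by rewrite /bisecants pairs_map count_map; apply: eq_count => p /=; rewrite ct.
Qed.

Lemma small_arc_map tau K' K : collineation tau -> small_arc K' K -> small_arc (map tau K') (map tau K).
Proof.
move=> ct [u n h4 c u' sub n' t].
have it := collineation_inj ct.
split; rewrite ?map_inj_uniq ?size_map ?trisecants_map //.
- move=> p q r s /mapP[a aK ->] /mapP[b bK ->] /mapP[c' cK ->] /mapP[d dK ->].
  rewrite !ct -[X in uniq X]/(map tau [:: a; b; c'; d]) map_inj_uniq //; exact: h4.
- move=> q; have [tau' _ Kt] := injF_bij it.
  rewrite -(Kt q) mem_map // => /c[a [b [c' [[aK bK cK] u3 h1 h2]]]].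
  exists (tau a), (tau b), (tau c'); rewrite !mem_map // !ct.
  split=> //; by rewrite -[X in uniq X]/(map tau [:: a; b; c']) map_inj_uniq.
by move=> q /mapP[p /sub pK ->]; rewrite map_f.
Qed.

(** The arcs are quantified here because bringing a core to normal form replaces K and K' by their
    images. *)
Definition core_occurs d x := exists K' K, small_arc K' K /\ {subset core d x <= K'}.

Lemma det_dup u v : [/\ det u u v = k0, det u v u = k0 & det v u u = k0].
Proof.
have h w z : det w w z = k0.
  by case: w z => [[w1 w2] w3] [[z1 z2] z3]; rewrite detE -[k0]/(0%R : gf); ring.
by split; rewrite ?(det_perm v u u).1 ?(det_perm u v u).2 h.
Qed.

Lemma det_rot u v w : det u v w = det v w u.
Proof. by rewrite (det_perm u v w).1 (det_perm v u w).2. Qed.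

Lemma linear_map_dual (k l m : gf) u v w p :
  linear_map (scale k (cross u v), scale l (cross v w), scale m (cross w u)) p =
  norm (k * det u v (rep p), l * det v w (rep p), m * det w u (rep p))%R.
Proof. by rewrite /linear_map /app /= !dot_scale !dot_cross. Qed.

Local Open Scope ring_scope.

(** Cramer's rule expresses det(e,a,c) f through e, a and c; pairing it with e and x gives this
    Grassmann-Plucker relation. *)
Lemma det_plucker (e a c f x : vec) :
  det e a c * det e f x = det f a c * det e e x + det e f c * det e a x + det e a f * det e c x.
Proof.
case: e a c f x => [[e1 e2] e3] [[a1 a2] a3] [[c1 c2] c3] [[f1 f2] f3] [[x1 x2] x3].
by rewrite !detE; ring.
Qed.

Lemma core_occurs_of K' K e a c f b d x : small_arc K' K ->
  {subset [:: e; a; c; f; b; d; x] <= K'} -> is_core e a c f b d x ->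
  (ratios e a c f b d x).1 != k0 -> (ratios e a c f b d x).2 != k0 ->
  core_occurs (ratios e a c f b d x).1 (ratios e a c f b d x).2.
Proof.
move=> gK sub; rewrite /is_core /ratios /= /gdiv !gmulE !ginvE.
case: ifP => // hb; case: ifP => // hd; case: ifP => // hx hf.
pose E := rep e; pose A := rep a; pose C := rep c; pose F := rep f.
pose B := rep b; pose D := rep d; pose X := rep x.
rewrite -/E -/A -/C -/F -/B -/D -/X -[k0]/(0 : gf).
set fa := det E F C; set fc := det E A F.
set b1 := det E B C / _; set b2 := det E A D / _; set b3 := det E X C / _.
rewrite !mulf_eq0 !negb_or !invr_eq0 => /andP[b2n b1n] /andP[b3n _].
(* Since the inverse of 0 is 0, nonzero ratios force all the determinants involved to be nonzero. *)
have /and3P[EBC BAC fan] : [&& det E B C != 0, det B A C != 0 & fa != 0].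
  by move: b1n; rewrite /b1 mulf_eq0 invr_eq0 mulf_eq0 !negb_or.
have /and3P[EAD DAC fcn] : [&& det E A D != 0, det D A C != 0 & fc != 0].
  by move: b2n; rewrite mulf_eq0 negb_or.
have /andP[EXC XAC] : (det E X C != 0) && (det X A C != 0).
  by move: b3n; rewrite mulf_eq0 negb_or => /and3P[-> ->].
have {}b2n : b2 != 0 by rewrite mulf_neq0 // invr_eq0 mulf_neq0.
have {}b3n : b3 != 0 by rewrite mulf_neq0 // invr_eq0 mulf_neq0.
have EAC : det E A C != 0.
  apply: contraNneq EBC => h; have ea : e != a.
    by apply: contraNneq fcn => ea; rewrite /fc /E /A ea; case: (det_dup (rep a) F) => ->.
  have eac : col e a c by apply/eqP.
  exact: (col_trans ea hb eac).
have fcv : fc^-1 != 0 by rewrite invr_eq0.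
have fav : fa^-1 != 0 by rewrite invr_eq0.
(* In the coordinates dual to a, c, f and b1 e the core takes its normal form. *)
pose M := (scale fc^-1 (cross E A), scale b1 (cross A C), scale fa^-1 (cross C E)).
have cM : collineation (linear_map M).
  apply: linear_collineation; rewrite /= det_scale det_cross.
  exact: mulf_neq0 (mulf_neq0 (mulf_neq0 fcv b1n) fav) (expf_neq0 2 EAC).
exists (map (linear_map M) K'), (map (linear_map M) K); split; first exact: small_arc_map.
have t p q : p \in [:: e; a; c; f; b; d; x] -> linear_map M p = q -> q \in map (linear_map M) K'.
  by move=> /sub pK <-; apply: map_f.
have LE p : linear_map M p =
    norm (fc^-1 * det E A (rep p), b1 * det A C (rep p), fa^-1 * det C E (rep p)).
  exact: linear_map_dual.
have nA (p q r : gf) : r != 0 -> norm (p, q, r) = Aff (p / r) (q / r).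
  by rewrite /norm is0E => /negPf ->.
have nI (p q : gf) : p != 0 -> norm (p, q, 0) = Inf (q / p).
  by rewrite /norm /= is0E => /negPf ->.
have D1 u v := let: And3 h _ _ := det_dup u v in h : det u u v = 0.
have D2 u v := let: And3 _ h _ := det_dup u v in h : det u v u = 0.
have D3 u v := let: And3 _ _ h := det_dup u v in h : det v u u = 0.
move: hb hd hx hf; rewrite /col -/A -/B -/C -/D -/E -/F -/X -[k0]/(0 : gf).
move=> /eqP hb /eqP hd /eqP hx /eqP hf.
have tE : linear_map M e = InfV.
  by rewrite LE -/E D2 D3 !mulr0.
have tA : linear_map M a = Aff k0 k0.
  rewrite LE -/A D3 D2 !mulr0 nA ?mul0r // mulf_neq0 ?invr_eq0 //.
  by rewrite det_rot.
have tC : linear_map M c = Inf k0.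
  by rewrite LE -/C D3 D2 !mulr0 nI ?mul0r // mulf_neq0 ?invr_eq0.
have tF : linear_map M f = Aff k1 k0.
  by rewrite LE -/F hf -/fc mulVf // mulr0 det_rot -/fa mulVf // nA ?oner_eq0 // mul0r divff ?oner_eq0.
have tB : linear_map M b = Aff k0 k1.
  rewrite LE -/B hb mulr0 (det_rot C E B); have -> : b1 * det A C B = fa^-1 * det E B C.
    by rewrite /b1 -[det A C B]det_rot invfM; field; rewrite BAC fan.
  by rewrite nA ?mul0r ?divff // mulf_neq0 ?invr_eq0.
have tD : linear_map M d = Inf (b2 / b1)^-1.
  rewrite LE -/D (det_perm C E D).1 hd mulr0 nI ?mulf_neq0 ?invr_eq0 //.
  by congr Inf; rewrite /b2 -[det A C D]det_rot; field; rewrite ?EAD ?DAC ?fcn ?b1n.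
have tX : linear_map M x = Aff k1 (b3 / b1)^-1.
  (* The first and third coordinates of the image of x agree, because e, f, x and a, c, f are
     collinear. *)
  have hX : fc^-1 * det E A X = fa^-1 * det C E X.
    have := det_plucker E A C F X; rewrite hx mulr0 (det_rot F A C) hf mul0r add0r.
    rewrite -/fa -/fc (det_perm C E X).1 => /esym/eqP; rewrite gadd_eq0 => /eqP h.
    by apply: (mulfI fan); rewrite mulrCA h; field; rewrite fan fcn.
  rewrite LE hX -/X (det_rot C E X) -/X nA ?divff ?mulf_neq0 ?invr_eq0 //.
  by congr Aff; rewrite /b3 -[det A C X]det_rot; field; rewrite ?EXC ?XAC ?fan ?b1n.
apply/allP; rewrite /= andbT -tX -tD -tB -tF -tC -tA -tE.
by rewrite !map_f // sub // !inE eqxx ?orbT.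
Qed.

Lemma core_occurs_relabel d x e a c f b d' x' :
  core_occurs d x -> {subset [:: e; a; c; f; b; d'; x'] <= core d x} ->
  is_core e a c f b d' x' ->
  (ratios e a c f b d' x').1 != k0 -> (ratios e a c f b d' x').2 != k0 ->
  core_occurs (ratios e a c f b d' x').1 (ratios e a c f b d' x').2.
Proof.
move=> [K' [K [gK sub]]] s; apply: (core_occurs_of gK) => p /s; exact: sub.
Qed.

Lemma core_occurs_swap d x : d != k0 -> x != k0 -> core_occurs d x -> core_occurs x d.
Proof.
move=> d0 x0 h.
pose e := InfV; pose a := Aff k0 k0; pose c := Aff k1 k0; pose f := Inf k0.
pose b := Aff k0 k1; pose d' := Aff k1 (ginv x); pose x' := Inf (ginv d).
have chk : [&& all (fun p => mem_point p (core d x)) [:: e; a; c; f; b; d'; x'], is_core e a c f b d' x'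
  & ratios e a c f b d' x' == (x, d)] by clear h; case: d d0 @x'; case: x x0 @d'.
case/and3P: chk => h1 h2 /eqP h3.
have := @core_occurs_relabel d x e a c f b d' x' h; rewrite h3; apply=> //.
by move=> p /(allP h1); rewrite mem_pointE.
Qed.

(** Exchanges the lines ea and ec; with the exchange of ec and ef in [core_occurs_swap] it generates
    all six permutations of the three lines through e. *)
Lemma core_occurs_rot d x : d != k0 -> x != k0 -> core_occurs d x ->
  core_occurs (ginv d) (gmul x (ginv d)).
Proof.
move=> d0 x0 h.
pose e := InfV; pose a := Inf k0; pose c := Aff k0 k0; pose f := Aff k1 k0.
pose b := Inf (ginv d); pose d' := Aff k0 k1; pose x' := Aff k1 (ginv x).
have chk : [&& all (fun p => mem_point p (core d x)) [:: e; a; c; f; b; d'; x'], is_core e a c f b d' x',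
  ratios e a c f b d' x' == (ginv d, gmul x (ginv d)), ginv d != k0 & gmul x (ginv d) != k0].
  by clear h; case: d d0 @b; case: x x0 @x'.
case/and5P: chk => h1 h2 /eqP h3 h4 h5.
have := @core_occurs_relabel d x e a c f b d' x' h; rewrite h3; apply=> //.
by move=> p /(allP h1); rewrite mem_pointE.
Qed.

Lemma core_occurs_frob d x : core_occurs d x -> core_occurs (gmul d d) (gmul x x).
Proof.
move=> [K' [K [gK sub]]]; exists (map frob K'), (map frob K); split.
  exact: small_arc_map frob_collineation gK.
have -> : core (gmul d d) (gmul x x) = map frob (core d x).
  by clear sub; case: d; case: x.
by move=> q /mapP[p /sub pK ->]; apply: map_f.
Qed.

Definition swap_images d x :=
  let d' := ginv d in let x' := ginv x in
  [:: (d, x); (d', gmul x d'); (x, d); (x', gmul d x'); (gmul x d', d'); (gmul d x', x')].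

Definition class_images d x := flatten [seq swap_images p.1 p.2 |
  p <- traject (fun p => (gmul p.1 p.1, gmul p.2 p.2)) (d, x) 4].

Lemma core_occurs_images d x p : d != k0 -> x != k0 -> core_occurs d x ->
  p \in class_images d x -> core_occurs p.1 p.2.
Proof.
move=> d0 x0 h /flattenP[s /mapP[q qt ->]].
have nz (u v : gf) : u != k0 -> v != k0 -> gmul u v != k0 by case: u; case: v.
have nzi (u : gf) : u != k0 -> ginv u != k0 by case: u.
have {qt d0 x0 h} [] : [/\ q.1 != k0, q.2 != k0 & core_occurs q.1 q.2].
  move: 4%N qt => n; elim: n d x d0 x0 h => // n IH d x d0 x0 h.
  rewrite trajectS inE => /predU1P[->//|]; apply: IH; rewrite ?nz //.
  exact: core_occurs_frob.
case: q => {}d {}x /= d0 x0 h.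
have ir := core_occurs_rot d0 x0 h; have is_ := core_occurs_swap d0 x0 h.
have := core_occurs_rot x0 d0 is_ => irs.
have isr := core_occurs_swap (nzi _ d0) (nz _ _ x0 (nzi _ d0)) ir.
have isrs := core_occurs_swap (nzi _ x0) (nz _ _ d0 (nzi _ x0)) irs.
by rewrite !inE => /or4P[|||/or3P[]] /eqP->.
Qed.

(** The six permutations and four Frobenius powers act on the 225 nonzero pairs with 15 orbits; each
    case is checked by evaluation. *)
Lemma class_repP d x : d != k0 -> x != k0 ->
  [&& core_class d x < 15 & nth (k1, k1) class_reps (core_class d x) \in class_images d x]%N.
Proof. by case: d; case: x. Qed.

Local Close Scope ring_scope.

Lemma core_class_nz d x : core_class d x < 15 -> (d != k0) /\ (x != k0).
Proof. by case: d => //; case: x. Qed.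

Definition rep_occurs i := core_occurs (nth (k1, k1) class_reps i).1 (nth (k1, k1) class_reps i).2.

Lemma core_occurs_rep d x : d != k0 -> x != k0 -> core_occurs d x -> rep_occurs (core_class d x).
Proof.
move=> d0 x0 h; case/andP: (class_repP d0 x0) => _; exact: core_occurs_images.
Qed.

Lemma small_arc_avoids i K' K : i < 15 -> small_arc K' K -> (forall j, j < i -> ~ rep_occurs j) ->
  avoids (earlier_class i) K'.
Proof.
move=> i15 gK IH e a c f b d x sub hc; apply/negP; rewrite /earlier_class => lt.
have [d0 x0] := core_class_nz (ltn_trans lt i15).
by apply: (IH _ lt); apply: core_occurs_rep => //; apply: core_occurs_of gK sub hc d0 x0.
Qed.

Definition bit_vectors : seq vec :=
  [:: (k0, k0, k1); (k0, k1, k0); (k0, k1, k1); (k1, k0, k0); (k1, k0, k1); (k1, k1, k0); (k1, k1, k1)].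

Definition fano_maps : seq (vec * vec * vec) :=
  [seq m <- [seq (p, w) | p <- [seq (u, v) | u <- bit_vectors, v <- bit_vectors],
  w <- bit_vectors] | ~~ is0 (det m.1.1 m.1.2 m.2)].
Definition fano := core k1 k1.

(** The points off the seven Fano lines number 273 - 7 - 7 * 14 = 168, which is also the order of
    GL(3,2). The target [Aff k2 k4] is one of them since 1, k2 and k4 are independent over GF(2). *)
Definition fano_transitive :=
  lazy_all (fun y => if mem_point y fano then true else
     if lazy_all (fun B => ~~ col B.1 B.2.1 y) (blocks fano) then
       lazy_has (fun m => point_eq (linear_map m y) (Aff k2 k4)) fano_maps
     else true) points.

Lemma fano_transitiveE : fano_transitive. Proof. by vm_compute. Qed.

Lemma fano_stable : lazy_all (fun m => lazy_all (fun p => mem_point p (map (linear_map m) fano)) fano) fano_maps.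
Proof. by vm_compute. Qed.

Lemma fano_extend K' K : small_arc K' K -> {subset fano <= K'} ->
  exists L' L, small_arc L' L /\ {subset Aff k2 k4 :: fano <= L'}.
Proof.
move=> gK sub; have [uK n h4 c uK' sK' n' t] := gK.
have uf : uniq fano by [].
have /hasP[y yK yf] : has (fun y => y \notin fano) K'.
  apply: contraT => /hasPn h; have := @uniq_leq_size _ K' fano uK'; rewrite n'.
  by apply=> z zK; have := h z zK; rewrite negbK.
have := fano_transitiveE; rewrite /fano_transitive lazy_allE => /allP /(_ y (mem_points y)).
rewrite mem_pointE (negPf yf) lazy_allE.
have fy : off_trisecants fano y.
  apply: (no4_off_trisecants h4); first by rewrite /= yf.
  by move=> z; rewrite inE => /predU1P[->|/sub]; apply: sK'.
rewrite -/(off_trisecants fano y) fy lazy_hasE => /hasP[m mf /eqP my].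
have := fano_stable; rewrite lazy_allE => /allP /(_ m mf); rewrite lazy_allE => /allP st.
have cm : collineation (linear_map m).
  by apply: linear_collineation; move: mf; rewrite mem_filter is0E => /andP[].
exists (map (linear_map m) K'), (map (linear_map m) K); split; first exact: small_arc_map.
move=> z; rewrite inE => /predU1P[->|/st]; first by rewrite -my map_f.
by rewrite mem_pointE => /mapP[p /sub pK ->]; rewrite map_f.
Qed.

(** The induction follows the order of exclusion: the earlier classes do not occur, so the cores
    that the search forbids are indeed absent from K'. *)
Lemma no_rep_occurs i : i < 15 -> ~ rep_occurs i.
Proof.
elim/ltn_ind: i => i IH i15 [K' [K [gK sub]]].
have {}IH j : j < i -> ~ rep_occurs j by move=> ji; apply: IH => //; apply: ltn_trans ji i15.
have r : run_class i.
  by have /allP := run_classes; apply; rewrite mem_iota.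
have fin L' L : small_arc L' L -> uniq (start_of i) -> {subset start_of i <= L'} -> False.
  move=> gL us ss; have [uK n h4 c uK' sK' n' t] := gL.
  apply: (run_sound uK n h4 c uK' sK' n' t (small_arc_avoids i15 gL IH) us ss r).
have us : uniq (start_of i).
  by move: i i15 {IH gK sub r fin}; do 15 case=> //.
have [i14|i14] := ltnP i 14.
  apply: fin gK us _; move: sub; rewrite /start_of; case: nth => d x /=.
  by rewrite i14.
have e : i = 14 by apply/eqP; rewrite eqn_leq i14 -ltnS i15.
subst i; have [L' [L [gL sL]]] := fano_extend gK sub.
exact: fin gL us sL.
Qed.

Lemma col_perms p q r : col p q r ->
  [/\ col p r q, col q p r, col q r p, col r p q & col r q p].
Proof.
by rewrite [col p r q]colAC [col q r p]colAC [col r q p]colC [col q r p]colAC [col r p q]colC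
  [col p r q]colAC [col q p r]colC => ->.
Qed.

Lemma ratios_neq0 e a c f b d x :
  [/\ ~~ col e b c, ~~ col b a c, ~~ col e f c & ~~ col e a f] ->
  [/\ ~~ col e a d, ~~ col d a c, ~~ col e x c & ~~ col x a c] ->
  (ratios e a c f b d x).1 != k0 /\ (ratios e a c f b d x).2 != k0.
Proof.
rewrite /col /ratios /= /gdiv => -[h1 h2 h3 h4] [h5 h6 h7 h8].
have M (u v : gf) : u != k0 -> v != k0 -> gmul u v != k0 by case: u; case: v.
have V (u : gf) : u != k0 -> ginv u != k0 by case: u.
by split; repeat first [assumption | apply/M | apply/V].
Qed.

Theorem no_small_complete K : uniq K -> no4 K -> complete K -> 14 < size K.
Proof.
move=> uK h4 cK; rewrite ltnNge; apply/negP => n14.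
have [K' [uK' sub n12 t17]] := core12 uK h4 cK n14.
have h4' : no4 K' by move=> a b c d /sub ? /sub ? /sub ? /sub ?; apply: h4.
have [e [a [c [f [b [d [x [s [hf eac] [ua ub] [uc ux] [hb hd hx]]]]]]]]] :=
  core_exists uK' h4' n12 t17.
have gK : small_arc K' K by [].
have hc : is_core e a c f b d x by rewrite /is_core hb hd hx hf.
move: ua; rewrite /= !inE negb_or andbT => /andP[/andP[ac af] cf].
move: ub; rewrite /= !inE negb_or andbT => /andP[/andP[ea eb] ab].
move: uc; rewrite /= !inE negb_or andbT => /andP[/andP[ec ed] cd].
move: ux; rewrite /= !inE negb_or andbT => /andP[/andP[ef ex] fx].
have [hb1 hb2 hb3 hb4 hb5] := col_perms hb; have [hd1 hd2 hd3 hd4 hd5] := col_perms hd.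
have [hx1 hx2 hx3 hx4 hx5] := col_perms hx; have [hf1 hf2 hf3 hf4 hf5] := col_perms hf.
have [ba ca fa] : [/\ b != a, c != a & f != a] by rewrite ![_ == a]eq_sym.
have efc : ~~ col e f c.
  by apply: contra eac => /col_perms[_ _ _ _ h]; case: (col_perms (col_trans cf hf3 h)).
have eaf : ~~ col e a f.
  by apply: contra eac => /col_perms[_ _ h _ _]; case: (col_perms (col_trans af hf1 h)).
have [d0 x0] : (ratios e a c f b d x).1 != k0 /\ (ratios e a c f b d x).2 != k0.
  apply: ratios_neq0; split=> //.
  - by apply: contra eac; apply: col_trans eb hb1.
  - by apply: contra eac => /col_perms[_ h _ _ _]; case: (col_perms (col_trans ab h hb3)).
  - by apply: contra eac => /col_perms[h _ _ _ _]; apply: col_trans ed h hd1.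
  - by apply: contra eac => /col_perms[_ _ _ h _]; case: (col_perms (col_trans cd h hd3)).
  - by apply: contra efc; apply: col_trans ex hx1.
  apply: contra eaf => /col_perms[_ _ h _ _].
  case: (col_perms (col_trans ac h hf)) => _ _ _ _ h'.
  by case: (col_perms (col_trans fx h' hx3)).
have co := core_occurs_of gK s hc d0 x0.
have /andP[i15 _] := class_repP d0 x0.
exact: no_rep_occurs i15 (core_occurs_rep d0 x0 co).
Qed.

(** * A complete arc of 15 points *)

(* Found by simulated annealing. *)
Definition arc15 : seq point :=
  [:: Aff k0 k2; Aff k0 k7; Aff k0 kc; Inf k5; Aff k1 kb; Aff k3 k5; Aff k3 ka; Aff k3 kb; Aff k4 k2; Aff k4 k9; Aff ka kb; Aff kc kd; Aff kd k6; Aff ke kf; Aff kf k9].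

(** The count includes a and b themselves, so it is the number of arc points on the line ab. *)
Lemma arc15_no4 : lazy_all (fun a => lazy_all (fun b => if point_eq a b then true else
  count (col a b) arc15 <= 3) arc15) arc15.
Proof. by vm_compute. Qed.

Lemma arc15_complete : lazy_all (fun q => if mem_point q arc15 then true else
  lazy_has (fun B => col B.1 B.2.1 q) (blocks arc15)) points.
Proof. by vm_compute. Qed.

Lemma arc15P : [/\ uniq arc15, size arc15 = 15, no4 arc15, complete arc15
  & exists a b c, [/\ {subset [:: a; b; c] <= arc15}, uniq [:: a; b; c] & col a b c]].
Proof.
have u : uniq arc15 by [].
split=> //.
- move=> a b c d aK bK cK dK /= ; rewrite !inE !negb_or -!andbA.
  move=> /and5P[ab ac ad bc /and3P[bd cd _]] h; apply/negP => h'.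
  have := arc15_no4; rewrite lazy_allE => /allP/(_ a aK); rewrite lazy_allE => /allP/(_ b bK).
  rewrite point_eqE (negPf ab) -size_filter leqNgt => /negP[].
  apply: (@uniq_leq_size _ [:: a; b; c; d]).
    by rewrite /= !inE !negb_or ab ac ad bc bd cd.
  move=> z; rewrite !inE mem_filter => /or4P[] /eqP->; apply/andP; split=> //.
    by rewrite colAC col_dup.
  by rewrite colC colAC col_dup.
- move=> q qK; have := arc15_complete; rewrite lazy_allE => /allP/(_ q (mem_points q)).
  rewrite mem_pointE (negPf qK) lazy_hasE => /hasP[[a [b c]] /(mem_blocks u)[m u3 h] hq].
  by exists a, b, c.
have : 0 < trisecants arc15 by vm_compute.
rewrite /trisecants; case E: (blocks arc15) => [//|[a [b c]] r] _.
have := @mem_blocks arc15 a b c u; rewrite E mem_head => /(_ isT)[[aK bK cK] u3 h].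
by exists a, b, c; split=> //; apply/allP; rewrite /= aK bK cK.
Qed.

(** * Coordinates for PG(2,16) *)

Local Open Scope ring_scope.

Section FieldIso.
Variable F : finFieldType.
Hypothesis cardF : #|F| = 16%N.

Lemma add_self (x : F) : x + x = 0.
Proof.
have c2 : 2%N \in [pchar F] by apply: (@card_finPcharP F 2 4).
exact: addrr_pchar2.
Qed.

Lemma exists_gen : exists x : F, x ^+ 4 = x + 1.
Proof.
(* p is (X^16 - X) / (X^4 + X + 1) in characteristic 2. *)
pose p : {poly F} := 'X^12 + 'X^9 + 'X^8 + 'X^6 + 'X^4 + 'X^3 + 'X^2 + 'X.
(* Degree 12 leaves at least four of the 16 elements that are not roots of p, hence are roots of the
   other factor. *)
have sp : size p = 13%N.
  rewrite /p -!addrA size_polyDl size_polyXn //.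
  do 6 (rewrite (leq_ltn_trans (size_polyD _ _)) // gtn_max size_polyXn /=).
  by rewrite size_polyX.
have [x px] : exists x, ~~ root p x.
  apply/existsP; apply: contraT => /existsPn h.
  have p0 : p != 0 by rewrite -size_poly_eq0 sp.
  have := @max_poly_roots _ p (enum F) p0.
  rewrite enum_uniq -cardE cardF sp => H; suff: false by []; apply: H => //.
  by apply/allP => x _; have := h x; rewrite negbK.
exists x; apply/eqP; rewrite -subr_eq0.
move: px; rewrite /root /p !hornerE => px.
have := expf_card x; rewrite cardF => e.
suff : (x ^+ 12 + x ^+ 9 + x ^+ 8 + x ^+ 6 + x ^+ 4 + x ^+ 3 + x ^+ 2 + x) * (x ^+ 4 - (x + 1)) == 0.
  by rewrite mulf_eq0 (negPf px).
have N (y : F) : - y = y by apply/eqP; rewrite -subr_eq0 -opprD add_self oppr0.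
(* The monomials that occur twice in the product and cancel. *)
pose t := x ^+ 13 + x ^+ 12 + x ^+ 10 + x ^+ 9 + x ^+ 8 + x ^+ 7 + x ^+ 6 + x ^+ 5 + x ^+ 4 + x ^+ 3 + x ^+ 2.
rewrite N; apply/eqP; transitivity (x ^+ 16 + x + (t + t)); first by rewrite /t; ring.
by rewrite e !add_self.
Qed.

Definition bits (a : gf) : bool * bool * bool * bool :=
  match a with
  | k0 => (false, false, false, false) | k1 => (true, false, false, false)
  | k2 => (false, true, false, false) | k3 => (true, true, false, false)
  | k4 => (false, false, true, false) | k5 => (true, false, true, false)
  | k6 => (false, true, true, false) | k7 => (true, true, true, false)
  | k8 => (false, false, false, true) | k9 => (true, false, false, true)
  | ka => (false, true, false, true) | kb => (true, true, false, true)
  | kc => (false, false, true, true) | kd => (true, false, true, true)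
  | ke => (false, true, true, true) | kf => (true, true, true, true)
  end.

(** The bits of a are its coordinates on 1, g, g^2, g^3. By additivity, multiplicativity reduces to
    multiplication by [k2], where g^4 = g + 1 enters. *)
Lemma gf_iso : exists phi : gf -> F, [/\ bijective phi, {morph phi : x y / x + y},
  {morph phi : x y / x * y}, phi 0 = 0 & phi 1 = 1].
Proof.
have [g g4] := exists_gen.
pose phi a := let: (a0, a1, a2, a3) := bits a in
  a0%:R + a1%:R * g + a2%:R * g ^+ 2 + a3%:R * g ^+ 3 : F.
have A : {morph phi : x y / x + y}.
  move=> x y; rewrite /phi.
  have -> : bits (x + y) = let: (a0, a1, a2, a3) := bits x in let: (b0, b1, b2, b3) := bits y in
    (a0 (+) b0, a1 (+) b1, a2 (+) b2, a3 (+) b3) by case: x; case: y.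
  case: (bits x) (bits y) => [[[a0 a1] a2] a3] [[[b0 b1] b2] b3].
  have D (b c : bool) : (b (+) c)%:R = b%:R + c%:R :> F.
    by case: b; case: c; rewrite ?addr0 ?add0r ?add_self.
  by rewrite !D; ring.
have P0 : phi 0 = 0 by rewrite /phi /= !mul0r !addr0.
have P1 : phi 1 = 1 by rewrite /phi /= !mul0r !addr0.
have X a : phi (k2 * a) = g * phi a.
  rewrite /phi; have -> : bits (k2 * a) = let: (a0, a1, a2, a3) := bits a in
    (a3, a0 (+) a3, a1, a2) by case: a.
  case: (bits a) => [[[a0 a1] a2] a3].
  have D (b c : bool) : (b (+) c)%:R = b%:R + c%:R :> F.
    by case: b; case: c; rewrite ?addr0 ?add0r ?add_self.
  rewrite D; transitivity (a0%:R * g + a1%:R * g ^+ 2 + a2%:R * g ^+ 3 + a3%:R * g ^+ 4).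
    by rewrite g4; ring.
  by ring.
have M : {morph phi : x y / x * y}.
  move=> x y.
  have -> : x * y = let: (a0, a1, a2, a3) := bits x in
    (if a0 then y else 0) + (if a1 then k2 * y else 0) + (if a2 then k2 * (k2 * y) else 0)
     + (if a3 then k2 * (k2 * (k2 * y)) else 0) by apply/geqP; case: x; case: y.
  rewrite {2}/phi; case: (bits x) => [[[a0 a1] a2] a3]; rewrite !A !(fun_if phi) !X P0.
  have D (b : bool) (z : F) : (if b then z else 0) = b%:R * z by case: b; rewrite ?mul1r ?mul0r.
  by rewrite !D; ring.
exists phi; split=> //.
apply: inj_card_bij; last by rewrite cardF cardT enumT unlock.
move=> x y e; apply/eqP; rewrite -gadd_eq0; apply: contraT => h.
have := P1; rewrite -(mulVf h) M A e add_self mulr0 => /esym/eqP.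
by rewrite oner_eq0.
Qed.
End FieldIso.

Local Close Scope ring_scope.

Local Open Scope ring_scope.

(** * Collinearity of subspaces and determinants *)

Lemma det3 (R : comPzRingType) (m : 'M[R]_3) (i0 := 0 : 'I_3) (i1 := 1 : 'I_3) (i2 := 2%:R : 'I_3) :
  \det m = m i0 i0 * (m i1 i1 * m i2 i2 - m i1 i2 * m i2 i1)
         + m i0 i1 * (m i1 i2 * m i2 i0 - m i1 i0 * m i2 i2)
         + m i0 i2 * (m i1 i0 * m i2 i1 - m i1 i1 * m i2 i0).
Proof.
pose f (i j : nat) := m (inord i) (inord j).
have fE i j : m i j = f i j by rewrite /f !inord_val.
rewrite (expand_det_row _ 0) !big_ord_recl big_ord0 /cofactor.
rewrite !(expand_det_row _ 0) !big_ord_recl !big_ord0 /cofactor !det_mx11 !mxE /=.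
by rewrite !fE /= /bump /=; ring.
Qed.

Section Plane.
Variable F : finFieldType.
Implicit Types P Q R : pg2_point F.

Definition coplanar (u v w : 'rV[F]_3) := 
  \det (\matrix_(i < 3) (if i == 0 then u else if i == 1 then v else w)) == 0.

(** Dependent vectors lie in the kernel of a nonzero linear form, which has dimension 2 even if they
    span less. *)
Lemma line_exists (u v w : 'rV[F]_3) : coplanar u v w ->
  exists L : {vspace 'rV[F]_3}, [/\ \dim L = 2%N, u \in L, v \in L & w \in L].
Proof.
rewrite /coplanar -det_tr => /det0P[n n0 h].
have E (i : 'I_3) : (row i (\matrix_(i < 3) (if i == 0 then u else if i == 1 then v else w))) *m n^T = 0.
  rewrite -row_mul; set m := (X in X *m _).
  by have -> : m *m n^T = 0; [apply: trmx_inj; rewrite trmx_mul trmxK h trmx0 | rewrite row0].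
pose f : 'Hom('rV[F]_3, 'rV[F]_1) := linfun (mulmxr n^T).
exists (lker f).
have := E 0; have := E 1; have := E 2%:R; rewrite !rowK /= => hw hv hu.
rewrite !memv_ker !lfunE /= hw hv hu !eqxx; split=> //.
have := limg_ker_dim f fullv; rewrite capfv dimvf /dim /=.
suff -> : \dim (limg f) = 1%N by rewrite mul1n addn1 => -[].
apply/eqP; rewrite eqn_leq; apply/andP; split.
  by apply: leq_trans (dimvS (subvf _)) _; rewrite dimvf /dim /= mul1n.
have /rV0Pn[j nj] := n0.
rewrite lt0n dimv_eq0; apply: contraNneq nj => f0.
have : f (delta_mx 0 j) \in limg f by apply: memv_img; exact: memvf.
rewrite f0 memv0 lfunE /= -rowE => /eqP/matrixP/(_ 0 0).
by rewrite !mxE => ->.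
Qed.

Lemma coplanar_on_line (u v w : 'rV[F]_3) (L : {vspace 'rV[F]_3}) :
  \dim L = 2%N -> u \in L -> v \in L -> w \in L -> coplanar u v w.
Proof.
move=> dL uL vL wL; rewrite /coplanar; set m := (X in \det X); apply: contraT => dm.
have fr : free [tuple of [:: u; v; w]].
  apply/freeP => k hk i; have [//|/eqP] := eqVneq (k i) 0.
  move=> ki; exfalso; move/negP: dm; apply; apply/det0P; exists (\row_i k i).
    by apply/rV0Pn; exists i; rewrite mxE; apply/eqP.
  rewrite mulmx_sum_row -[RHS]hk; apply: eq_bigr => j _; rewrite mxE rowK; congr (_ *: _).
  by case: j => [[|[|[|]]]].
have : (\dim <<[:: u; v; w]>> <= \dim L)%N.
  by apply/dimvS/span_subvP => x; rewrite !inE => /or3P[] /eqP->.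
by rewrite dL; move: fr; rewrite /free /= => /eqP ->.
Qed.

Lemma collinear3 P Q R : collinear [set P; Q; R] <->
  exists L : {vspace 'rV[F]_3}, [/\ \dim L = 2%N, (val P <= L)%VS, (val Q <= L)%VS & (val R <= L)%VS].
Proof.
split.
  case/existsP=> L /forall_inP h; exists (val L); split; first exact/eqP/(valP L).
  - by apply: h; rewrite !inE eqxx.
  - by apply: h; rewrite !inE eqxx orbT.
  by apply: h; rewrite !inE eqxx orbT.
case=> L [/eqP dL hP hQ hR]; apply/existsP; exists (Sub L dL : pg2_line F).
by apply/forall_inP => S; rewrite !inE /incident SubK -orbA => /or3P[] /eqP->.
Qed.

Lemma point_join P Q (L : {vspace 'rV[F]_3}) : P != Q -> \dim L = 2%N ->
  (val P <= L)%VS -> (val Q <= L)%VS -> L = (val P + val Q)%VS.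
Proof.
move=> PQ dL hP hQ; apply/eqP; rewrite eq_sym eqEdim subv_add hP hQ dL /=.
have dP := eqP (valP P); have dQ := eqP (valP Q).
have : val P != val Q by rewrite (inj_eq val_inj).
rewrite ltnNge; apply: contra => h; have sP : (val P <= val P + val Q)%VS := addvSl _ _.
have sQ : (val Q <= val P + val Q)%VS := addvSr _ _.
have eP : val P = (val P + val Q)%VS by apply/eqP; rewrite eqEdim sP dP.
by apply/eqP; rewrite [LHS]eP; apply/esym/eqP; rewrite eqEdim sQ dQ.
Qed.

(** Every line containing P and Q is their join, so the lines obtained for the various R
    coincide. *)
Lemma collinear_join P Q (A : {set pg2_point F}) : P != Q -> P \in A -> Q \in A ->
  (forall R, R \in A -> collinear [set P; Q; R]) -> collinear A.
Proof.
move=> PQ PA QA h; have /collinear3[L [dL hP hQ _]] := h P PA.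
apply/existsP; exists (Sub L (introT eqP dL) : pg2_line F); apply/forall_inP => R RA.
have /collinear3[L' [dL' hP' hQ' hR']] := h R RA; rewrite /incident SubK.
by rewrite (point_join PQ dL hP hQ) -(point_join PQ dL' hP' hQ').
Qed.

Lemma collinear_sub (A B : {set pg2_point F}) : A \subset B -> collinear B -> collinear A.
Proof.
move=> /subsetP AB /existsP[L /forall_inP h]; apply/existsP; exists L.
by apply/forall_inP => P /AB; apply: h.
Qed.
End Plane.

Local Close Scope ring_scope.

Local Open Scope ring_scope.

Lemma coordinates (F : finFieldType) (cardF : #|F| = 16%N) :
  exists g : point -> pg2_point F, bijective g /\
  forall p q r, collinear [set g p; g q; g r] = col p q r.
Proof.
have [phi [bphi phiD phiM phi0 phi1]] := gf_iso cardF.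
have iphi := bij_inj bphi.
pose rv (v : vec) : 'rV[F]_3 :=
  \row_j (if j == 0 then phi v.1.1 else if j == 1 then phi v.1.2 else phi v.2).
have rv_inj : injective rv.
  move=> [[x y] z] [[x' y'] z'] /matrixP e.
  have := e 0 0; have := e 0 1; have := e 0 2%:R; rewrite !mxE /=.
  by move=> /iphi -> /iphi -> /iphi ->.
have rv0 : rv (k0, k0, k0) = 0.
  by apply/rowP => j; rewrite !mxE /= -[k0]/(0 : gf) phi0 !if_same.
have rep0 p : rv (rep p) != 0.
  by rewrite -rv0 (inj_eq rv_inj); case: p => *; apply/eqP.
have dim1 p : \dim <[rv (rep p)]>%VS == 1%N by rewrite dim_vline rep0.
pose g p : pg2_point F := Sub <[rv (rep p)]>%VS (dim1 p).
have gval p : val (g p) = <[rv (rep p)]>%VS by rewrite SubK.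
have rvZ k v : rv (scale k v) = phi k *: rv v.
  have M' a b : phi (gmul a b) = phi a * phi b := phiM a b.
  case: v => [[x y] z]; apply/rowP => j; rewrite !mxE /= !M'.
  by case: ifP => // _; case: ifP.
have phi0E a : (phi a == 0) = (a == 0) by rewrite -phi0 (inj_eq iphi).
have gcol p q r : collinear [set g p; g q; g r] = col p q r.
  have cE : coplanar (rv (rep p)) (rv (rep q)) (rv (rep r)) = col p q r.
    rewrite /coplanar det3 !mxE /= /col.
    case: (rep p) (rep q) (rep r) => [[u1 u2] u3] [[v1 v2] v3] [[w1 w2] w3] /=.
    have N (a : F) : - a = a by apply/eqP; rewrite -subr_eq0 -opprD (add_self cardF) oppr0.
    have D' a b : phi (gadd a b) = phi a + phi b := phiD a b.
    have M' a b : phi (gmul a b) = phi a * phi b := phiM a b.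
    by rewrite -[RHS]phi0E !(D', M') /= !N -addrA.
  rewrite -cE; apply/idP/idP.
    by move/collinear3 => [L []]; rewrite !gval; apply: coplanar_on_line.
  move/line_exists => [L [dL hp hq hr]]; apply/collinear3; exists L.
  by rewrite !gval.
exists g; split=> //.
have gi : injective g.
  move=> p q e; apply/eqP; apply: contraT => /exists_noncol[r].
  by rewrite -gcol e gcol col_dup.
apply: (Bijective (g := fun P => odflt InfV [pick p | g p == P])) => [p|P].
  case: pickP => [q /eqP/gi -> //|/(_ p)]; by rewrite eqxx.
case: pickP => [q /eqP //|h]; exfalso.
have [phi' _ Kphi] := bphi.
(* Surjectivity: the coordinates of a spanning vector are pulled back to the concrete field and
   normalised by [norm]. *)
have [v Pv] : exists v, val P = <[rv v]>%VS.
  exists (phi' (vpick (val P) 0 0), phi' (vpick (val P) 0 1), phi' (vpick (val P) 0 2%:R)).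
  have -> : rv (phi' (vpick (val P) 0 0), phi' (vpick (val P) 0 1), phi' (vpick (val P) 0 2%:R)) = vpick (val P).
    apply/rowP => j; rewrite mxE /= !Kphi; case: j => [[|[|[|//]]]] i /=;
    by congr (fun_of_matrix _ _ _); apply/val_inj.
  apply/esym/eqP; rewrite eqEdim -memvE memv_pick (eqP (valP P)) dim_vline vpick0.
  by rewrite -dimv_eq0 (eqP (valP P)).
have v0 : v != (k0, k0, k0).
  apply: contraTneq (valP P) => e; by rewrite Pv e rv0 dim_vline eqxx.
have [k kn e] := rep_norm v0.
move/negP: (h (norm v)); apply; apply/eqP/val_inj; rewrite gval Pv e rvZ.
apply/eqP; rewrite eqEsubv -!memvE; apply/andP; split.
  by apply/vlineP; exists (phi k).
apply/vlineP; exists (phi k)^-1; rewrite scalerA mulVf ?scale1r //.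
by rewrite phi0E.
Qed.

Local Close Scope ring_scope.

(** * Arcs as sets of points and as lists *)

Lemma cards3 (T : finType) (a b c : T) : uniq [:: a; b; c] -> #|[set a; b; c]| = 3.
Proof.
rewrite /= !inE negb_or andbT => /andP[/andP[ab ac] bc].
rewrite setUC cardsU1 setUC cardsU1 cards1 !inE negb_or.
by rewrite ![c == _]eq_sym ac bc eq_sym ab.
Qed.

Lemma cards4 (T : finType) (a b c d : T) : uniq [:: a; b; c; d] -> #|[set a; b; c; d]| = 4.
Proof.
move=> u; have u3 : uniq [:: a; b; c] by apply: subseq_uniq u; rewrite (prefix_subseq [:: a; b; c] [:: d]).
move: u; rewrite setUC cardsU1 cards3 // -(rot_uniq 3) /= => /andP[+ _].
by rewrite !inE -!orbA => ->.
Qed.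

Section Transport.
Variables (F : finFieldType) (g : point -> pg2_point F).
Hypotheses (bg : bijective g) (gcol : forall p q r, collinear [set g p; g q; g r] = col p q r).
Let gi : injective g := bij_inj bg.

Lemma collinear4 a b c d : a != b -> col a b c -> col a b d ->
  collinear [set g a; g b; g c; g d].
Proof.
move=> ab h h'; apply: (@collinear_join _ (g a) (g b)).
- by rewrite (inj_eq gi).
- by rewrite !inE eqxx.
- by rewrite !inE eqxx orbT.
move=> R; rewrite !inE -!orbA => /or4P[] /eqP->; rewrite gcol //.
  by rewrite colAC col_dup.
by rewrite colC colAC col_dup.
Qed.

Lemma set_of_seq (A : {set pg2_point F}) : exists s, [/\ uniq s, size s = #|A| &
  forall p, (g p \in A) = (p \in s)].
Proof.
exists (enum [set p | g p \in A]); split; rewrite ?enum_uniq -?cardE //.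
  rewrite -(card_imset _ gi); apply: eq_card => P; apply/imsetP/idP.
    by case=> p; rewrite inE => pA ->.
  by have [g' _ Kg] := bg; exists (g' P); rewrite ?inE Kg.
by move=> p; rewrite mem_enum inE.
Qed.

Lemma seq_of_arc n (K : {set pg2_point F}) : complete_arc n 3 K ->
  exists s, [/\ uniq s, no4 s, complete s & size s = n].
Proof.
case=> -[cK K4 [T [TK T3 cT]]] max; have [s [us ss sK]] := set_of_seq K.
have s4 : no4 s.
  move=> a b c d; rewrite -!sK => aK bK cK' dK u h; apply/negP => h'.
  have ab : a != b by move: u; rewrite /= inE negb_or => /andP[/andP[]].
  have gu : uniq [:: g a; g b; g c; g d].
    by rewrite -[X in uniq X]/(map g [:: a; b; c; d]) map_inj_uniq.
  have := K4 [set g a; g b; g c; g d]; rewrite cards4 // collinear4 // => H.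
  suff: false by []; apply: H => //.
  by apply/subsetP => P; rewrite !inE -!orbA => /or4P[] /eqP->.
exists s; split=> //; last by rewrite ss.
move=> q qs; case hq: (has (fun B => col B.1 B.2.1 q) (blocks s)).
  case/hasP: hq => [[a [b c]] /(mem_blocks us)[m u3 h] hq].
  by exists a, b, c.
(* A point q on no trisecant could be added to K, contradicting maximality. *)
have qK : g q \notin K by rewrite sK.
case: max; exists (g q |: K); split; last exact: subsetUr.
split; first by rewrite cardsU1 qK cK.
  move=> A AK A4; apply/negP => cA.
  have [qA|qA] := boolP (g q \in A); last first.
    have AK' : A \subset K.
      apply/subsetP => P PA; have := subsetP AK P PA; rewrite !inE => /predU1P[e|//].
      by rewrite -e PA in qA.
    by have := K4 A AK' A4; rewrite cA.
  have [t [ut st tA]] := set_of_seq (A :\ g q).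
  have t3 : size t = 3 by rewrite st; have := cardsD1 (g q) A; rewrite qA A4 add1n => -[<-].
  case: t ut t3 tA {st} => [|a [|b [|c [|]]]] // u _ tA.
  have tK z : z \in [:: a; b; c] -> z \in s.
    rewrite -tA !inE (inj_eq gi) -sK => /andP[zq zA].
    by have := subsetP AK _ zA; rewrite !inE (inj_eq gi) (negPf zq).
  have sub z : z \in [:: a; b; c] -> g z \in A by rewrite -tA inE => /andP[].
  have h : col a b c.
    rewrite -gcol; apply: collinear_sub cA; apply/subsetP => P.
    by rewrite !inE -!orbA => /or3P[] /eqP->; apply: sub; rewrite !inE eqxx ?orbT.
  have hq' : col a b q.
    rewrite -gcol; apply: collinear_sub cA; apply/subsetP => P.
    by rewrite !inE -!orbA => /or3P[] /eqP-> //; apply: sub; rewrite !inE eqxx ?orbT.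
  have [||| B Bs hB] := @blocksP s a b c _ _ _ u h; try by apply: tK; rewrite !inE eqxx ?orbT.
  move/negP: hq; apply; apply/hasP; exists B => //.
  apply: (triple_col u h hq'); rewrite -?(perm_mem hB) ?inE ?eqxx ?orbT //.
  have : uniq [:: B.1; B.2.1; B.2.2] by rewrite (perm_uniq hB).
  by rewrite /= inE negb_or => /andP[/andP[]].
by exists T; split=> //; apply: subset_trans TK (subsetUr _ _).
Qed.

Lemma arc_of_seq s : uniq s -> no4 s -> complete s ->
  (exists a b c, [/\ {subset [:: a; b; c] <= s}, uniq [:: a; b; c] & col a b c]) ->
  complete_arc (size s) 3 [set g p | p in s].
Proof.
move=> us s4 cs [a [b [c [sub u h]]]].
have cardK : #|[set g p | p in s]| = size s by rewrite card_imset // (card_uniqP us).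
have memK p : (g p \in [set g p | p in s]) = (p \in s) by rewrite mem_imset.
split.
  split=> //.
    move=> A AK A4; apply/negP => cA.
    have [t [ut st tA]] := set_of_seq A.
    case: t ut st tA => [|a' [|b' [|c' [|d' [|]]]]]; rewrite A4 // => u' _ tA.
    have ts z : z \in [:: a'; b'; c'; d'] -> z \in s.
      by rewrite -tA => zA; rewrite -memK; apply: (subsetP AK).
    have tc x y z : {subset [:: x; y; z] <= [:: a'; b'; c'; d']} -> col x y z.
      move=> ss; rewrite -gcol; apply: collinear_sub cA; apply/subsetP => P.
      by rewrite !inE -!orbA => /or3P[] /eqP->; rewrite tA; apply: ss; rewrite !inE eqxx ?orbT.
    have := s4 a' b' c' d'; rewrite !ts ?inE ?eqxx ?orbT // => /(_ isT isT isT isT u').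
    rewrite !tc => [/(_ isT)//||]; apply/allP; by rewrite /= !inE !eqxx ?orbT.
  have gu : uniq [:: g a; g b; g c].
    by rewrite -[X in uniq X]/(map g [:: a; b; c]) map_inj_uniq.
  exists [set g a; g b; g c]; split; rewrite ?gcol // ?cards3 //.
  by apply/subsetP => P; rewrite !inE -!orbA => /or3P[] /eqP->; rewrite memK sub // !inE eqxx ?orbT.
case=> K' [[cK' K4 _] sK].
(* A point of the larger arc outside the given one lies on one of its trisecants, which makes four
   points of K' collinear. *)
have [P PK' PK] : exists2 P, P \in K' & P \notin [set g p | p in s].
  apply/subsetPn; apply/negP => h1; have := subset_leq_card h1; rewrite cK' cardK.
  by rewrite ltnn.
have [g' _ Kg] := bg; have qs : g' P \notin s by rewrite -memK Kg.
have [a' [b' [c' [[as_ bs cs'] u' h' hq]]]] := cs _ qs.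
have u4 : uniq [:: g' P; a'; b'; c'].
  rewrite cons_uniq u' andbT !inE !negb_or.
  by rewrite !(contraNneq _ qs) // => ->.
have ab : a' != b' by move: u'; rewrite /= inE negb_or => /andP[/andP[]].
have := K4 [set g a'; g b'; g c'; g (g' P)]; rewrite collinear4 // cards4; last first.
  rewrite -[X in uniq X]/(map g [:: a'; b'; c'; g' P]) map_inj_uniq //.
  by rewrite -(rot_uniq 1) in u4.
move=> H; suff: false by []; apply: H => //; apply/subsetP => Q.
rewrite !inE -!orbA => /or4P[] /eqP->; last by rewrite Kg.
- by apply: (subsetP sK); rewrite memK.
- by apply: (subsetP sK); rewrite memK.
by apply: (subsetP sK); rewrite memK.
Qed.
End Transport.

Theorem theorem2 (F : finFieldType) (cardF : #|F| = 16) :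
  (exists K : {set pg2_point F}, complete_arc 15 3 K) /\
  (forall (n : nat) (K : {set pg2_point F}), complete_arc n 3 K -> 15 <= n).
Proof.
have [g [bg gcol]] := coordinates cardF; split.
  have [u n s4 c t] := arc15P.
  by exists [set g p | p in arc15]; rewrite -n; apply: arc_of_seq.
move=> n K /(seq_of_arc bg gcol)[s [us s4 cs <-]].
exact: no_small_complete.
Qed.
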